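(* Two Hadamard graphs are quantum isomorphic if and only if they have the same size. Likewise, two looped Hadamard graphs are quantum isomorphic if and only if they have the same size.
   Context: Hadamard matrix of size $N$: an $N\times N$ matrix $H$ with entries $\pm1$ and $HH^{T}=N\cdot I=H^{T}H$. With $J$ the all-ones matrix and $H^\pm=\frac12(J\pm H)$, the Hadamard graph of $H$ is the graph on $4N$ vertices (its size) with adjacency matrix $$A=\begin{pmatrix}0&0&H^+&H^-\\0&0&H^-&H^+\\H^{+T}&H^{-T}&0&0\\H^{-T}&H^{+T}&0&0\end{pmatrix},$$ and the looped Hadamard graph of $H$ has adjacency matrix $A_0$ obtained from $A$ by replacing the first two diagonal zero blocks by identity matrices. A matrix $u=(u^i_j)$ with entries in a unital $*$-algebra is a magic unitary if it is unitary, $(u^i_j)^2=u^i_j=(u^i_j)^*$, and all row sums and column sums equal $1$. Graphs with adjacency matrices $A$ and $A'$ ($n\times n$ and $n'\times n'$) are quantum isomorphic if there is an $n'\times n$ magic unitary $u$ with entries in some (nonzero, unital) $*$-algebra such that $uA=A'u$. *)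

(* Defs.v *)
From HB Require Import structures.
From mathcomp Require Import all_boot all_order all_algebra.
From mathcomp Require Import reals.
From mathcomp.real_closed Require Import complex.

Set Implicit Arguments.
Unset Strict Implicit.
Unset Printing Implicit Defensive.

Import Order.TTheory GRing.Theory Num.Theory.

Local Open Scope ring_scope.

(* Unital *-algebras over C. An [algType] is a [nzRingType], so [1 != 0] is
   built in: these algebras are nonzero. *)
HB.mixin Record Algebra_hasStar (C : numClosedFieldType) A
    of GRing.Algebra C A := {
  star : A -> A;
  starK : involutive star;
  starD : {morph star : x y / x + y};
  starM : forall x y : A, star (x * y) = star y * star x;
  starZ : forall (c : C) (x : A), star (c *: x) = c^* *: star x
}.

#[short(type="starAlgType")]
HB.structure Definition StarAlgebra (C : numClosedFieldType) :=
  {A of GRing.Algebra C A & Algebra_hasStar C A}.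

Definition adjointmx (C : numClosedFieldType) (A : starAlgType C) (m n : nat)
  (u : 'M[A]_(m, n)) : 'M[A]_(n, m) := \matrix_(i, j) star (u j i).

Definition magic_unitary (C : numClosedFieldType) (A : starAlgType C)
    (m n : nat) (u : 'M[A]_(m, n)) : Prop :=
  [/\ u *m adjointmx u = 1%:M,
      adjointmx u *m u = 1%:M,
      forall i j, u i j ^+ 2 = u i j /\ star (u i j) = u i j,
      forall i, \sum_j u i j = 1
    & forall j, \sum_i u i j = 1].

(* Scalar matrices act on matrices over [A] through the structure map
   [in_alg A : c |-> c *: 1]. *)
Definition quantum_isomorphic (C : numClosedFieldType) (n n' : nat)
    (G : 'M[C]_n) (G' : 'M[C]_n') : Prop :=
  exists (A : starAlgType C) (u : 'M[A]_(n', n)),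
    magic_unitary u /\
    u *m map_mx (in_alg A) G = map_mx (in_alg A) G' *m u.

Definition hadamard (C : numClosedFieldType) (N : nat) (H : 'M[C]_N) : Prop :=
  [/\ forall i j, H i j = 1 \/ H i j = -1,
      H *m H^T = (N%:R)%:M
    & H^T *m H = (N%:R)%:M].

Definition hplus (C : numClosedFieldType) (N : nat) (H : 'M[C]_N) : 'M[C]_N :=
  2^-1 *: (const_mx 1 + H).

Definition hminus (C : numClosedFieldType) (N : nat) (H : 'M[C]_N) : 'M[C]_N :=
  2^-1 *: (const_mx 1 - H).

Definition hadamard_graph (C : numClosedFieldType) (N : nat) (H : 'M[C]_N) :
    'M[C]_((N + N) + (N + N)) :=
  block_mx
    (block_mx 0 0
              0 0)                         (block_mx (hplus H)  (hminus H)
                                                     (hminus H) (hplus H))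
    (block_mx (hplus H)^T  (hminus H)^T
              (hminus H)^T (hplus H)^T)    (block_mx 0 0
                                                     0 0).

Definition looped_hadamard_graph (C : numClosedFieldType) (N : nat)
    (H : 'M[C]_N) : 'M[C]_((N + N) + (N + N)) :=
  block_mx
    (block_mx 1%:M 0
              0    1%:M)                   (block_mx (hplus H)  (hminus H)
                                                     (hminus H) (hplus H))
    (block_mx (hplus H)^T  (hminus H)^T
              (hminus H)^T (hplus H)^T)    (block_mx 0 0
                                                     0 0).

(* Main.v *)
Require Import Defs.
From HB Require Import structures.
From mathcomp Require Import all_boot all_order all_algebra.
From mathcomp Require Import reals.
From mathcomp.real_closed Require Import complex.
From mathcomp Require Import generic_quotient boolp ring zify.

Set Implicit Arguments.
Unset Strict Implicit.
Unset Printing Implicit Defensive.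

Import Order.TTheory GRing.Theory Num.Theory.

Local Open Scope ring_scope.
Local Open Scope quotient_scope.

(** Summing all entries of a magic unitary by rows or by columns gives the
number of its rows and the number of its columns; these scalars of a nonzero
complex algebra agree only if the two integers do.  So quantum isomorphic graphs
have equally many vertices ([magic_unitary_size]).

Conversely, let [H] and [K] be Hadamard matrices of the same size [N].  Call a
square matrix [x] over a star algebra signed magic if its entries are
self-adjoint, distinct entries of a row or of a column multiply to zero, and the
squares of the entries of every row and column sum to [1]: a quantum signed
permutation.  Splitting each entry into its positive and negative parts makes
[x] a magic unitary of size [2N].  If [x] and [y = K^-1 x H] are both signed
magic, the block diagonal matrix made of the splittings of [x] and [y] is a
quantum isomorphism of the Hadamard graphs, looped or not
([quantum_isomorphic_block]).  What remains is to find a nonzero star algebra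
that contains such an [x].

It is the algebra of noncommutative polynomials in the [x i j], modulo those
[a] with [phi (u a v) = 0] for all words [u] and [v], for a functional [phi] with
[phi 1 = 1] ([word_algebra]).  Such a quotient is never zero, and [x], [y] are
signed magic in it as soon as [phi] annihilates the relations that say so, inside
every word ([respects_relations]).  In degree [k] the values of [phi] form an
operator [p] from the [k]-th tensor power of the space of [H] to that of [K], and
the relations say that [p] intertwines, at every pair of adjacent sites, the
following operators built from [H] with those built from [K]: the white gate,
which projects onto the span of the [e_j * e_j] for the standard basis; the
black gate, which does the same for the columns of the Hadamard matrix; the cup,
which inserts the sum of the [e_a * e_a]; and its adjoint, the cap.  The operator
[p] is taken to be the partial isometry that sends every tensor obtained by gates
for [H] from a row of cups to the tensor obtained in the same way for [K], and
vanishes on the orthogonal complement.  It intertwines the operators above,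
because they and their adjoints preserve these tensors
([transport_intertwines]).

The partial isometry exists provided that the inner products of such tensors
do not depend on the Hadamard matrix ([pairing_vec]).  Here is the reason.  The
two bases are unbiased, so that gates of different colours at the same sites
commute and multiply to the projection onto the cup, while gates of different
colours at neighbouring pairs of sites satisfy the braid-like relation
[P Q P = N^-1 P].  Gates of the same colour commute.  Let the colours alternate
with the position: the gates fall into two families which commute with each other
and which both satisfy the Temperley-Lieb relations, with constants that only
involve [N].  These relations alone reduce [e w e], for [e] the projection onto
the first cup and [w] a word in the gates, to a multiple of [w' e] where
[w'] leaves the first two sites alone ([reduces_double_sandwich]); so the inner
product of two tensors can be evaluated by removing one cup after the other,
with the same scalars for all Hadamard matrices of size [N]. *)

(** * Words in two commuting Temperley-Lieb families *)

(** The letter [(b, i)] stands for the generator number [i] of the family [b]; it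
acts on the sites [i] and [i.+1]. *)
Definition letter : Type := (bool * nat)%type.

Definition commuting (x y : letter) : bool :=
  [|| x.1 != y.1, (x.2.+1 < y.2)%N | (y.2.+1 < x.2)%N].

Definition neighbours (x y : letter) : bool :=
  (x.1 == y.1) && ((x.2.+1 == y.2) || (y.2.+1 == x.2)).

Definition fits (k : nat) (x : letter) : bool := (x.2.+1 < k)%N.

(** [tl_red d k c u v] derives the equality of [u] with [c] times [v] for two
commuting Temperley-Lieb families on [k] sites, normalised to projections.  The
scalar is part of the derivation, because one derivation is later read for two
different Hadamard matrices and has to give the same value for both. *)
Inductive tl_red (F : fieldType) (d : F) (k : nat) :
    F -> seq letter -> seq letter -> Prop :=
| red_refl w : tl_red d k 1 w w
| red_trans a b u v w :
    tl_red d k a u v -> tl_red d k b v w -> tl_red d k (a * b) u w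
| red_cat a p q u v : tl_red d k a u v -> tl_red d k a (p ++ u ++ q) (p ++ v ++ q)
| red_idem x : tl_red d k 1 [:: x; x] [:: x]
| red_comm x y : commuting x y -> tl_red d k 1 [:: x; y] [:: y; x]
| red_braid x y : fits k x -> fits k y -> neighbours x y ->
    tl_red d k d^-1 [:: x; y; x] [:: x].

Section Words.
Variables (F : fieldType) (d : F) (k : nat).
Implicit Types (u v w p q : seq letter) (x y : letter).

Definition reduces w w' := exists c, tl_red d k c w w'.

Lemma reduces_refl w : reduces w w.
Proof. by exists 1; exact: red_refl. Qed.

Lemma reduces_trans v u w : reduces u v -> reduces v w -> reduces u w.
Proof.
by move=> [a ra] [b rb]; exists (a * b); apply: red_trans ra rb.
Qed.

Lemma reduces_catl p u v : reduces u v -> reduces (p ++ u) (p ++ v).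
Proof. by case=> a /(red_cat p [::]); rewrite !cats0; exists a. Qed.

Lemma reduces_catr q u v : reduces u v -> reduces (u ++ q) (v ++ q).
Proof. by case=> a /(red_cat [::] q); exists a. Qed.

Lemma reduces_cons x u v : reduces u v -> reduces (x :: u) (x :: v).
Proof. exact: (reduces_catl [:: x]). Qed.

Lemma reduces_idem x q : reduces [:: x, x & q] (x :: q).
Proof. by apply: (@reduces_catr q [:: x; x] [:: x]); exists 1; apply: red_idem. Qed.

Lemma reduces_braid x y q : fits k x -> fits k y -> neighbours x y ->
  reduces [:: x, y, x & q] (x :: q).
Proof.
move=> fx fy nxy; apply: (@reduces_catr q [:: x; y; x] [:: x]).
by exists d^-1; apply: red_braid.
Qed.

Lemma commuting_sym x y : commuting x y = commuting y x.
Proof. by rewrite /commuting eq_sym [X in _ || X]orbC. Qed.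

Lemma reduces_moveR x u q : all (commuting x) u ->
  reduces (x :: u ++ q) (u ++ x :: q).
Proof.
elim: u => [|y u IH] /=; first by move=> _; exact: reduces_refl.
case/andP=> cxy cu; apply: (@reduces_trans [:: y, x & u ++ q]).
  by apply: (@reduces_catr (u ++ q) [:: x; y] [:: y; x]); exists 1; apply: red_comm.
by apply: reduces_cons; apply: IH.
Qed.

Lemma reduces_moveL x u q : all (commuting x) u ->
  reduces (u ++ x :: q) (x :: u ++ q).
Proof.
elim: u => [|y u IH] /=; first by move=> _; exact: reduces_refl.
case/andP=> cxy cu; apply: (@reduces_trans [:: y, x & u ++ q]).
  by apply: reduces_cons; apply: IH.
apply: (@reduces_catr (u ++ q) [:: y; x] [:: x; y]); exists 1; apply: red_comm.
by rewrite commuting_sym.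
Qed.

Definition above (b : bool) (m : nat) : pred letter :=
  fun x => [&& x.1 == b, (m <= x.2)%N & fits k x].

Lemma aboveW b m w : all (above b m.+1) w -> all (above b m) w.
Proof.
by apply: sub_all => x /and3P[? /ltnW ? ?]; apply/and3P.
Qed.

Lemma commuting_above b m w : all (above b m.+2) w -> all (commuting (b, m)) w.
Proof.
by apply: sub_all => x /and3P[_ lt _]; rewrite /commuting /= lt orbT.
Qed.

(** In Jones' normal form the lowest generator occurs at most once. *)
Inductive jones_form (b : bool) (m : nat) : seq letter -> Prop :=
| jones_without w : all (above b m.+1) w -> jones_form b m w
| jones_with u v : fits k (b, m) -> all (above b m.+1) u -> all (above b m.+1) v ->
    jones_form b m (u ++ (b, m) :: v).

(** Two occurrences of the lowest generator [m] enclose a word in the generators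
above [m], which by induction contains [m.+1] at most once.  What does not
involve [m.+1] commutes with [m], and then either idempotence or the braid
relation merges the two occurrences.  The induction is on the length, since the
enclosed word is normalised with respect to [m.+1]. *)
Lemma reduces_jones b n : forall m w, (size w <= n)%N -> all (above b m) w ->
  exists w', [/\ reduces w w', (size w' <= size w)%N & jones_form b m w'].
Proof.
elim: n => [|n IHn] m [|x w] //= sz; try by
  exists [::]; split=> //; [exact: reduces_refl | exact: jones_without].
case/andP=> ax aw; have [w1 [r1 s1 j1]] := IHn m w sz aw.
have{r1} r1 := reduces_cons x r1.
have [/and3P[/eqP xb xm xf]] := (ax, leqP m.+1 x.2).
case=> [xm1 | mx].
  have ax1: above b m.+1 x by rewrite /above xb eqxx xm1.
  exists (x :: w1); split=> //.
  case: j1 => [w2 a2 | u v fm au av]; first by apply: jones_without; rewrite /= ax1.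
  by apply: (@jones_with b m (x :: u)) => //=; rewrite ?ax1.
have{ax mx xm} ex: x = (b, m) by rewrite [x]surjective_pairing xb; congr (_, _); lia.
case: j1 r1 s1 => [w2 a2 | u v fm au av] r1 s1.
  exists (x :: w2); split=> //; rewrite ex.
  by apply: (@jones_with b m [::]); rewrite // -ex.
have szu: (size u <= n)%N by move: s1; rewrite size_cat /=; lia.
have [u' [ru su ju]] := IHn m.+1 u szu au.
have{ru r1} r2: reduces (x :: w) (x :: u' ++ (b, m) :: v).
  by apply: reduces_trans r1 _; apply: reduces_cons; apply: reduces_catr.
case: ju su r2 => [u2 au2 | u1 u2 fm1 au1 au2] su r2.
  exists (u2 ++ (b, m) :: v); split; last by apply: jones_with => //; apply: aboveW.
    apply: reduces_trans r2 _; rewrite ex.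
    apply: (@reduces_trans (u2 ++ [:: (b, m), (b, m) & v])).
      by apply: reduces_moveR; apply: commuting_above.
    by apply: reduces_catl; apply: reduces_idem.
  by move: s1 su; rewrite !size_cat /=; lia.
exists (u1 ++ (b, m) :: (u2 ++ v)); split.
- apply: reduces_trans r2 _; rewrite ex -catA.
  apply: (@reduces_trans (u1 ++ (b, m) :: ((b, m.+1) :: u2) ++ (b, m) :: v)).
    by apply: reduces_moveR; apply: commuting_above.
  apply: reduces_catl => /=.
  apply: (@reduces_trans [:: (b, m), (b, m.+1), (b, m) & u2 ++ v]).
    do 2!apply: reduces_cons; apply: reduces_moveL; exact: commuting_above.
  by apply: reduces_braid; rewrite /neighbours ?eqxx.
- by move: s1 su; rewrite !size_cat /= size_cat /=; lia.
apply: jones_with; [by rewrite -ex | exact: aboveW |].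
by rewrite all_cat av andbT; apply: aboveW.
Qed.

(** Compressing by the generator of the first two sites frees these sites: the
letters that touch them are absorbed, by idempotence or by the braid relation. *)
Lemma reduces_sandwich b w : fits k (b, 0%N) -> all (above b 0) w ->
  exists2 w', reduces ((b, 0%N) :: w ++ [:: (b, 0%N)]) (w' ++ [:: (b, 0%N)])
            & all (above b 2) w'.
Proof.
set x := (b, 0%N) => fx aw.
have inner u : all (above b 1) u ->
    exists2 w', reduces (x :: u ++ [:: x]) (w' ++ [:: x]) & all (above b 2) w'.
  move=> au; have [u' [ru _ ju]] := reduces_jones (leqnn _) au.
  have {}ru : reduces (x :: u ++ [:: x]) (x :: u' ++ [:: x]).
    by apply: reduces_cons; apply: reduces_catr.
  case: ju ru => [u2 a2 | u1 u2 f1 a1 a2] ru.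
    exists u2 => //; apply: reduces_trans ru _.
    apply: (@reduces_trans (u2 ++ [:: x; x])).
      by apply: reduces_moveR; apply: commuting_above.
    by apply: reduces_catl; apply: reduces_idem.
  exists (u1 ++ u2); last by rewrite all_cat a1.
  apply: reduces_trans ru _; rewrite -!catA.
  apply: (@reduces_trans (u1 ++ x :: ((b, 1%N) :: u2) ++ [:: x])).
    by apply: reduces_moveR; apply: commuting_above.
  apply: reduces_catl => /=.
  apply: (@reduces_trans [:: x, (b, 1%N), x & u2 ++ [::]]).
    do 2!apply: reduces_cons; apply: reduces_moveL; exact: commuting_above.
  apply: (@reduces_trans (x :: u2 ++ [::])).
    by apply: reduces_braid; rewrite /neighbours ?eqxx.
  by apply: reduces_moveR; apply: commuting_above.
have [w1 [r1 _ j1]] := reduces_jones (leqnn _) aw.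
have {}r1 : reduces (x :: w ++ [:: x]) (x :: w1 ++ [:: x]).
  by apply: reduces_cons; apply: reduces_catr.
case: j1 r1 => [w2 a2 | u v _ au av] r1.
  by have [w' r' a'] := inner w2 a2; exists w' => //; apply: reduces_trans r1 r'.
have [u' ru au'] := inner u au; have [v' rv av'] := inner v av.
exists (u' ++ v'); last by rewrite all_cat au'.
apply: reduces_trans r1 _; rewrite -catA /=.
apply: (@reduces_trans ((u' ++ [:: x]) ++ v ++ [:: x])).
  have -> : x :: u ++ (b, 0%N) :: v ++ [:: x] = (x :: u ++ [:: x]) ++ v ++ [:: x].
    by rewrite /= -catA.
  exact: reduces_catr.
by rewrite -!catA; apply: reduces_catl.
Qed.

Lemma reduces_sort w :
  reduces w ([seq x <- w | x.1] ++ [seq x <- w | ~~ x.1]).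
Proof.
elim: w => [|x w IH] /=; first exact: reduces_refl.
apply: reduces_trans (reduces_cons x IH) _.
case: ifP => xb /=; first exact: reduces_refl.
apply: reduces_moveR; apply/allP=> y; rewrite mem_filter => /andP[y1 _].
by rewrite /commuting xb y1.
Qed.

(** The product of the first generators of the two families will act as the
projection onto a cup at the first two sites, so this is the step that removes a
cup from a closed diagram. *)
Lemma reduces_double_sandwich w : (1 < k)%N -> all (fits k) w ->
  exists2 w', reduces ([:: (true, 0%N); (false, 0%N)] ++ w
                          ++ [:: (true, 0%N); (false, 0%N)])
                      (w' ++ [:: (true, 0%N); (false, 0%N)])
            & all (fun x => (1 < x.2)%N && fits k x) w'.
Proof.
move=> k2 fw; set x := (true, 0%N); set y := (false, 0%N).
set wt := [seq z <- w | z.1]; set wf := [seq z <- w | ~~ z.1].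
have sub b : all (above b 0) [seq z <- w | z.1 == b].
  by rewrite all_filter; apply: sub_all fw => z fz /=; rewrite /above fz; case: (_ == _).
have at_ : all (above true 0) wt.
  by have := sub true; rewrite (eq_filter (a2 := fun z => z.1)) // => -[[]].
have af : all (above false 0) wf.
  by have := sub false; rewrite (eq_filter (a2 := fun z => ~~ z.1)) // => -[[]].
have [ut rt aut] := reduces_sandwich k2 at_.
have [uf rf auf] := reduces_sandwich k2 af.
have cross b v : all (above b 0) v -> all (commuting (~~ b, 0%N)) v.
  by apply: sub_all => z /and3P[/eqP zb _ _]; rewrite /commuting zb /=; case: b zb.
have weak b v : all (above b 2) v -> all (above b 0) v.
  by apply: sub_all => z /and3P[? _ ?]; apply/and3P.
exists (ut ++ uf); last first.
  by rewrite all_cat; apply/andP; split;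
     [move: aut | move: auf]; apply: sub_all => z /and3P[_ ? ?]; apply/andP.
apply: (@reduces_trans ([:: x; y] ++ (wt ++ wf) ++ [:: x; y])).
  by apply: reduces_catl; apply: reduces_catr; apply: reduces_sort.
apply: (@reduces_trans (x :: wt ++ x :: y :: wf ++ [:: y])) => /=.
  apply: reduces_cons; rewrite -catA.
  apply: (@reduces_trans (wt ++ y :: wf ++ [:: x; y])).
    by apply: reduces_moveR; apply: (cross true).
  apply: reduces_catl.
  apply: (@reduces_trans (y :: x :: wf ++ [:: y])).
    by apply: reduces_cons; apply: reduces_moveL; apply: (cross false).
  by apply: (@reduces_moveR y [:: x]).
apply: (@reduces_trans (ut ++ x :: uf ++ [:: y])).
  apply: (@reduces_trans ((x :: wt ++ [:: x]) ++ uf ++ [:: y])).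
    by rewrite /= -catA /=; apply: reduces_cons; apply: reduces_catl;
       apply: reduces_cons.
  have -> : ut ++ x :: uf ++ [:: y] = (ut ++ [:: x]) ++ uf ++ [:: y].
    by rewrite -catA.
  exact: reduces_catr.
rewrite -catA; apply: reduces_catl.
by apply: reduces_moveR; apply: (cross false); apply: weak.
Qed.

End Words.

(** * The gates of a Hadamard matrix on two adjacent sites *)

Section Gates.
Variables (F : realFieldType) (N : nat).
Implicit Types (f g : seq 'I_N -> F) (s t : seq 'I_N) (c : bool).

(** Hadamard matrices are taken over an ordered field here, because the partial
isometry between invariant tensors rests on the positivity of the inner
product. *)
Definition sign_hadamard (h : 'I_N -> 'I_N -> F) : Prop :=
  [/\ forall i j, h i j * h i j = 1,
      forall j l, \sum_i h i j * h i l = N%:R * (j == l)%:R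
    & forall i k, \sum_j h i j * h k j = N%:R * (i == k)%:R].

Lemma sum_delta (X : 'I_N -> F) j : \sum_l (j == l)%:R * X l = X j.
Proof.
rewrite (bigD1 j) //= eqxx mul1r big1 ?addr0 // => l.
by rewrite eq_sym => /negPf->; rewrite mul0r.
Qed.

Lemma sum_deltar (X : 'I_N -> F) j : \sum_l (l == j)%:R * X l = X j.
Proof. by rewrite -[RHS]sum_delta; apply: eq_bigr => l _; rewrite eq_sym. Qed.

(** Every product of two gates is computed by this rearrangement, which pairs the
vectors of the outer gate with those of the inner one. *)
Lemma contract2 (A B : 'I_N -> F) (C D : 'I_N -> 'I_N -> F) (X : 'I_N -> F) x :
  \sum_a \sum_b A a * B b * (x * \sum_l C l a * D l b * X l) =
  x * \sum_l (\sum_a A a * C l a) * (\sum_b B b * D l b) * X l.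
Proof.
rewrite mulr_sumr (eq_bigr (fun a => \sum_l x * (A a * C l a) * (\sum_b B b * D l b) * X l)).
  rewrite exchange_big /=; apply: eq_bigr => l _.
  by rewrite -!mulr_suml -mulr_sumr !mulrA.
move=> a _; rewrite (eq_bigr (fun b => \sum_l A a * B b * (x * (C l a * D l b * X l)))).
  rewrite exchange_big /=; apply: eq_bigr => l _.
  by rewrite mulr_sumr mulr_suml; apply: eq_bigr => b _; ring.
by move=> b _; rewrite mulr_sumr mulr_sumr.
Qed.

Variable h : 'I_N -> 'I_N -> F.

(** The two colours are two orthogonal bases: the standard one (white, [false]) and
the columns of [h] (black, [true]); [weight] is the squared length of their
vectors. *)
Definition base c (j a : 'I_N) : F := if c then h a j else (a == j)%:R.

Definition weight c : F := if c then N%:R else 1.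

(** Tensors are functions on words.  This is the partial inner product, over the
first two sites, with the square of a basis vector. *)
Definition project c (j : 'I_N) f s : F :=
  \sum_a \sum_b base c j a * base c j b * f [:: a, b & s].

(** The orthogonal projection, at the sites [i] and [i.+1], onto the span of the
squares of the basis vectors of a given colour; it gives [0] on words that are too
short to have these sites. *)
Fixpoint gate c (i : nat) f s {struct i} : F :=
  match i, s with
  | 0%N, [:: a, b & t] =>
      weight c ^- 2 * \sum_j base c j a * base c j b * project c j f t
  | i'.+1, a :: t => gate c i' (fun r => f (a :: r)) t
  | _, _ => 0
  end.

Lemma gate0E c f a b s : gate c 0 f [:: a, b & s] =
  weight c ^- 2 * \sum_j base c j a * base c j b * project c j f s.
Proof. by []. Qed.

Lemma gateSE c i f a s : gate c i.+1 f (a :: s) = gate c i (fun r => f (a :: r)) s.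
Proof. by []. Qed.

Lemma eq_gate c i f g s :
  (forall t, size t = size s -> f t = g t) -> gate c i f s = gate c i g s.
Proof.
elim: i f g s => [|i IH] f g [|a s] //= efg; last first.
  by apply: IH => t st; apply: efg; rewrite /= st.
case: s efg => [|b s] efg //; congr (_ * _); apply: eq_bigr => j _.
by congr (_ * _); apply: eq_bigr => x _; apply: eq_bigr => y _; rewrite efg.
Qed.

Lemma gate_sum c i (T : Type) (r : seq T) (P : pred T) (f : T -> seq 'I_N -> F) s :
  gate c i (fun t => \sum_(m <- r | P m) f m t) s =
  \sum_(m <- r | P m) gate c i (f m) s.
Proof.
elim: i f s => [|i IH] f [|a s] //=; [by rewrite big1 | | by rewrite big1].
case: s => [|b s] /=; first by rewrite big1.
rewrite -[RHS]mulr_sumr [in RHS]exchange_big /=; congr (_ * _); apply: eq_bigr => j _.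
rewrite -[RHS]mulr_sumr; congr (_ * _); rewrite /project [RHS]exchange_big /=.
apply: eq_bigr => x _; rewrite [RHS]exchange_big /=; apply: eq_bigr => y _.
by rewrite mulr_sumr.
Qed.

Lemma gateZ c i x f s : gate c i (fun t => x * f t) s = x * gate c i f s.
Proof.
elim: i f s => [|i IH] f [|a s] //=; rewrite ?mulr0 //.
case: s => [|b s]; rewrite ?mulr0 // mulrCA; congr (_ * _).
rewrite mulr_sumr; apply: eq_bigr => j _.
rewrite mulrCA; congr (_ * _); rewrite /project mulr_sumr; apply: eq_bigr => y _.
by rewrite mulr_sumr; apply: eq_bigr => z _; rewrite mulrCA.
Qed.

Lemma gate_short c i f s : (size s <= i.+1)%N -> gate c i f s = 0.
Proof. by elim: i f s => [|i IH] f [|a [|b s]] //= sz; apply: IH. Qed.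

Lemma gate_cat c i p f s :
  gate c (size p + i) f (p ++ s) = gate c i (fun t => f (p ++ t)) s.
Proof. by elim: p f => [|a p IH] f //=; rewrite IH. Qed.

Hypothesis N_gt0 : (0 < N)%N.
Hypothesis hh : sign_hadamard h.

Lemma N_neq0 : N%:R != 0 :> F.
Proof. by rewrite pnatr_eq0 -lt0n. Qed.

Lemma weight_neq0 c : weight c != 0.
Proof. by case: c; rewrite /weight ?oner_eq0 // N_neq0. Qed.

Lemma weightM c : weight c * weight (~~ c) = N%:R.
Proof. by case: c; rewrite /weight /= ?mulr1 ?mul1r. Qed.

Lemma base_orthogonal c j l :
  \sum_a base c j a * base c l a = weight c * (j == l)%:R.
Proof.
case: hh => _ hc _; rewrite /base /weight; case: c; first exact: hc.
by rewrite sum_deltar mul1r.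
Qed.

Lemma base_complete c a b :
  \sum_j base c j a * base c j b = weight c * (a == b)%:R.
Proof.
case: hh => _ _ hr; rewrite /base /weight; case: c; first exact: hr.
by rewrite sum_delta mul1r eq_sym.
Qed.

Lemma base_unbiased c j l :
  (\sum_a base c j a * base (~~ c) l a) * (\sum_a base c j a * base (~~ c) l a) = 1.
Proof.
case: hh => h1 _ _; rewrite /base; case: c => /=; last by rewrite sum_deltar h1.
by under eq_bigr do rewrite mulrC; rewrite sum_deltar h1.
Qed.

Lemma project_gate c j f s : project c j (gate c 0 f) s = project c j f s.
Proof.
rewrite [LHS]/project; under eq_bigr do under eq_bigr do rewrite gate0E.
rewrite contract2 (eq_bigr (fun l => (j == l)%:R * (weight c ^+ 2 * project c l f s))).
  by rewrite sum_delta mulrA mulVf ?mul1r // expf_neq0 // weight_neq0.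
by move=> l _; rewrite !base_orthogonal; case: eqP => _ /=; rewrite ?mulr0n ?mulr1n; ring.
Qed.

Lemma gate_idem0 c f s : gate c 0 (gate c 0 f) s = gate c 0 f s.
Proof. by case: s => [|a [|b s]] //; rewrite !gate0E; under eq_bigr do rewrite project_gate. Qed.

Definition trace2 f s := \sum_a f [:: a, a & s].

Lemma sum_project c f s : \sum_j project c j f s = weight c * trace2 f s.
Proof.
rewrite exchange_big mulr_sumr /=; apply: eq_bigr => a _.
rewrite exchange_big /= (eq_bigr (fun b => (a == b)%:R * (weight c * f [:: a, b & s]))).
  by rewrite sum_delta.
by move=> b _; rewrite -mulr_suml base_complete; ring.
Qed.

(** The inner product of a white and a black basis vector is a sign, whose square
disappears: the white and the black gate multiply to the projection onto the
cup. *)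
Lemma gate_mixed c f a b s :
  gate c 0 (gate (~~ c) 0 f) [:: a, b & s] = N%:R^-1 * ((a == b)%:R * trace2 f s).
Proof.
rewrite gate0E.
have e j : project c j (gate (~~ c) 0 f) s = (weight (~~ c))^-1 * trace2 f s.
  rewrite [LHS]/project; under eq_bigr do under eq_bigr do rewrite gate0E.
  rewrite contract2; under eq_bigr do rewrite base_unbiased mul1r.
  rewrite sum_project mulrA; congr (_ * _).
  by have := weight_neq0 (~~ c) => w0; field.
under eq_bigr do rewrite e.
rewrite -mulr_suml base_complete -(weightM c).
by have := weight_neq0 c; have := weight_neq0 (~~ c) => w0 w1; field; apply/andP.
Qed.

Lemma gate_mixedC0 c f s :
  gate c 0 (gate (~~ c) 0 f) s = gate (~~ c) 0 (gate c 0 f) s.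
Proof.
case: s => [|a [|b s]] //; rewrite gate_mixed.
by have := gate_mixed (~~ c) f a b s; rewrite negbK => ->.
Qed.

(** Both products are the projection onto the span of the cubes of the basis
vectors, at three consecutive sites. *)
Lemma gate_sameC0 c f s :
  gate c 0 (gate c 1 f) s = gate c 1 (gate c 0 f) s.
Proof.
case: s => [|a [|b [|d s]]] //.
- rewrite [RHS]gate_short // gate0E big1 ?mulr0 // => j _.
  by rewrite /project big1 ?mulr0 // => x _; rewrite big1 // => y _; rewrite mulr0.
(* [X j] pairs [f] with the cube of the basis vector [j] *)
pose X j := \sum_x \sum_y \sum_z base c j x * base c j y * base c j z * f [:: x, y, z & s].
have -> : gate c 0 (gate c 1 f) [:: a, b, d & s] =
    weight c ^- 3 * \sum_j base c j a * base c j b * base c j d * X j.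
  have e j : project c j (gate c 1 f) (d :: s) = (weight c)^-1 * (base c j d * X j).
    rewrite [LHS]/project.
    under eq_bigr => x _ do under eq_bigr => y _ do rewrite gateSE gate0E mulr_sumr mulr_sumr.
    under eq_bigr => x _ do rewrite exchange_big /=.
    rewrite (eq_bigr (fun x => (weight c)^-1 * (base c j d *
        (\sum_y \sum_z base c j x * base c j y * base c j z * f [:: x, y, z & s]))));
      last first.
      move=> x _.
      rewrite (eq_bigr (fun l => (j == l)%:R * ((weight c)^-1 * base c j x *
          base c l d * project c l (fun r => f (x :: r)) s))); last first.
        move=> l _; rewrite (eq_bigr (fun y => (base c j y * base c l y) *
          (weight c ^- 2 * base c j x * base c l d *
             project c l (fun r => f (x :: r)) s))); last first.
          by move=> y _; ring.
        rewrite -mulr_suml base_orthogonal.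
        by have := weight_neq0 c => w0; field.
      rewrite sum_delta -!mulrA; congr (_ * _).
      rewrite mulrCA /project; congr (_ * _); rewrite mulr_sumr; apply: eq_bigr => y _.
      by rewrite mulr_sumr; apply: eq_bigr => z _; ring.
    by rewrite -mulr_sumr -mulr_sumr.
  rewrite gate0E; under eq_bigr do rewrite e.
  rewrite !mulr_sumr; apply: eq_bigr => j _.
  by have := weight_neq0 c => w0; field.
rewrite gateSE gate0E.
have e j : project c j (fun r => gate c 0 f (a :: r)) s = (weight c)^-1 * (base c j a * X j).
  rewrite [LHS]/project.
  under eq_bigr => x _ do under eq_bigr => y _ do rewrite gate0E.
  have -> : \sum_x \sum_y base c j x * base c j y *
        (weight c ^- 2 * \sum_l base c l a * base c l x * project c l f (y :: s))
     = \sum_y \sum_l (\sum_x base c j x * base c l x) *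
        (weight c ^- 2 * base c j y * base c l a * project c l f (y :: s)).
    rewrite exchange_big /=; apply: eq_bigr => y _.
    under [RHS]eq_bigr do rewrite mulr_suml.
    rewrite [RHS]exchange_big /=; apply: eq_bigr => x _.
    by rewrite !mulr_sumr; apply: eq_bigr => l _; ring.
  rewrite (eq_bigr (fun y => (weight c)^-1 * (base c j a * (base c j y * project c j f (y :: s))))); last first.
    move=> y _; rewrite (eq_bigr (fun l => (j == l)%:R * ((weight c)^-1 *
      (base c l a * (base c j y * project c l f (y :: s)))))) ?sum_delta // => l _.
    rewrite base_orthogonal.
    by have := weight_neq0 c => w0; field.
  rewrite -!mulr_sumr; congr (_ * (_ * _)).
  rewrite /X; under [RHS]eq_bigr do rewrite exchange_big.
  rewrite [RHS]exchange_big /=; apply: eq_bigr => y _.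
  rewrite mulr_sumr; apply: eq_bigr => x _; rewrite mulr_sumr; apply: eq_bigr => z _.
  by ring.
under [in RHS]eq_bigr do rewrite e.
rewrite !mulr_sumr; apply: eq_bigr => j _.
by have := weight_neq0 c => w0; field.
Qed.
(** The braid relation at three sites, read after pairing the first two of them
with a basis vector.  The outer gates force their basis vectors to agree; the
inner products with the basis of the other colour then appear squared, and the
sum that is left is the completeness of that basis. *)
Lemma project_braid c l f d s :
  project c l (gate (~~ c) 1 (gate c 0 f)) (d :: s) =
  N%:R^-1 * project c l f (d :: s).
Proof.
have w0 := weight_neq0 c; have w1 := weight_neq0 (~~ c).
pose th m := \sum_y base c l y * base (~~ c) m y.
pose Z m a := project (~~ c) m (fun r => gate c 0 f (a :: r)) s.
have eZ m : \sum_a base c l a * Z m a =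
    (weight c)^-1 * th m * \sum_z base (~~ c) m z * project c l f (z :: s).
  transitivity (\sum_z \sum_a \sum_y base c l a * (base (~~ c) m y * base (~~ c) m z *
      (weight c ^- 2 * \sum_j base c j a * base c j y * project c j f (z :: s)))).
    rewrite [RHS]exchange_big; apply: eq_bigr => a _.
    rewrite [RHS]exchange_big mulr_sumr; apply: eq_bigr => y _.
    by rewrite mulr_sumr.
  rewrite mulr_sumr; apply: eq_bigr => z _.
  rewrite (eq_bigr (fun a => \sum_j base c l a * base c j a *
     ((\sum_y base c j y * base (~~ c) m y) * (base (~~ c) m z *
        (weight c ^- 2 * project c j f (z :: s)))))); last first.
    move=> a _; under eq_bigr do rewrite !mulr_sumr.
    rewrite exchange_big /=; apply: eq_bigr => j _.
    by rewrite mulr_suml mulr_sumr; apply: eq_bigr => y _; ring.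
  rewrite exchange_big /=.
  under eq_bigr do rewrite -mulr_suml base_orthogonal.
  rewrite (eq_bigr (fun j => (l == j)%:R * ((weight c)^-1 *
     (\sum_y base c j y * base (~~ c) m y) * (base (~~ c) m z *
        project c j f (z :: s))))) ?sum_delta // => j _.
  by field.
rewrite [LHS]/project.
rewrite (eq_bigr (fun a => \sum_b base c l b * base c l a *
  (weight (~~ c) ^- 2 * \sum_m base (~~ c) m b * (base (~~ c) m d * Z m a) * 1))); last first.
  move=> a _; apply: eq_bigr => b _; rewrite gateSE gate0E [base c l a * _]mulrC.
  by congr (_ * (_ * _)); apply: eq_bigr => m _; rewrite mulr1 mulrA.
rewrite exchange_big contract2 /=.
rewrite (eq_bigr (fun m => \sum_z base (~~ c) m d * base (~~ c) m z *
   ((weight c)^-1 * project c l f (z :: s)))); last first.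
  move=> m _; rewrite -/(th m) mulr1.
  under eq_bigr do rewrite mulrCA.
  rewrite -mulr_sumr eZ.
  have t1 : th m * th m = 1 := base_unbiased c l m.
  transitivity ((th m * th m) * (base (~~ c) m d * ((weight c)^-1 *
     \sum_z base (~~ c) m z * project c l f (z :: s)))); first by ring.
  by rewrite t1 mul1r !mulr_sumr; apply: eq_bigr => z _; ring.
rewrite exchange_big /= (eq_bigr (fun z => (d == z)%:R * (weight (~~ c) *
   ((weight c)^-1 * project c l f (z :: s))))); last first.
  by move=> z _; rewrite -mulr_suml base_complete; ring.
by rewrite sum_delta -(weightM c); field; apply/andP.
Qed.
(** The mirror image of [project_braid], where the gate of the other colour is on
the left. *)
Lemma project_braid_succ c l f a s :
  project c l (fun r => gate (~~ c) 0 (gate c 1 f) (a :: r)) s =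
  N%:R^-1 * project c l (fun r => f (a :: r)) s.
Proof.
have w0 := weight_neq0 c; have w1 := weight_neq0 (~~ c).
pose th m := \sum_y base c l y * base (~~ c) m y.
pose Y m d := project (~~ c) m (gate c 1 f) (d :: s).
have eY m : \sum_d base c l d * Y m d =
    (weight c)^-1 * th m * \sum_x base (~~ c) m x * project c l (fun r => f (x :: r)) s.
  transitivity (\sum_x \sum_d \sum_y base c l d * (base (~~ c) m x * base (~~ c) m y *
      (weight c ^- 2 * \sum_j base c j y * base c j d * project c j (fun r => f (x :: r)) s))).
    rewrite [RHS]exchange_big; apply: eq_bigr => d _.
    rewrite mulr_sumr; apply: eq_bigr => x _.
    by rewrite mulr_sumr.
  rewrite mulr_sumr; apply: eq_bigr => x _.
  rewrite (eq_bigr (fun d => \sum_j base c l d * base c j d *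
     ((\sum_y base c j y * base (~~ c) m y) * (base (~~ c) m x *
        (weight c ^- 2 * project c j (fun r => f (x :: r)) s))))); last first.
    move=> d _; under eq_bigr do rewrite !mulr_sumr.
    rewrite exchange_big /=; apply: eq_bigr => j _.
    by rewrite mulr_suml mulr_sumr; apply: eq_bigr => y _; ring.
  rewrite exchange_big /=.
  under eq_bigr do rewrite -mulr_suml base_orthogonal.
  rewrite (eq_bigr (fun j => (l == j)%:R * ((weight c)^-1 *
     (\sum_y base c j y * base (~~ c) m y) * (base (~~ c) m x *
        project c j (fun r => f (x :: r)) s)))) ?sum_delta // => j _.
  by field.
rewrite [LHS]/project.
rewrite (eq_bigr (fun b => \sum_d base c l b * base c l d *
  (weight (~~ c) ^- 2 * \sum_m base (~~ c) m b * Y m d * base (~~ c) m a))); last first.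
  move=> b _; apply: eq_bigr => d _; rewrite gate0E.
  by congr (_ * (_ * _)); apply: eq_bigr => m _; rewrite -/(Y m d); ring.
rewrite contract2 /=.
rewrite (eq_bigr (fun m => \sum_x base (~~ c) m a * base (~~ c) m x *
   ((weight c)^-1 * project c l (fun r => f (x :: r)) s))); last first.
  move=> m _; rewrite -/(th m) eY.
  have t1 : th m * th m = 1 := base_unbiased c l m.
  transitivity ((th m * th m) * (base (~~ c) m a * ((weight c)^-1 *
     \sum_x base (~~ c) m x * project c l (fun r => f (x :: r)) s))); first by ring.
  by rewrite t1 mul1r !mulr_sumr; apply: eq_bigr => x _; ring.
rewrite exchange_big /= (eq_bigr (fun x => (a == x)%:R * (weight (~~ c) *
   ((weight c)^-1 * project c l (fun r => f (x :: r)) s)))); last first.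
  by move=> x _; rewrite -mulr_suml base_complete; ring.
by rewrite sum_delta -(weightM c); field; apply/andP.
Qed.

End Gates.

(** * Gates, cups and caps at arbitrary sites *)

(** The colours of the gates of one family alternate along the sites.  Hence gates of
different families differ in colour at the same sites and agree in colour at
neighbouring pairs of sites, and commute in both cases. *)
Definition colour (x : letter) : bool := x.1 (+) odd x.2.

Definition shift2 (w : seq letter) := [seq (x.1, x.2.+2) | x <- w].

Section Positions.
Variables (F : realFieldType) (N : nat).
Implicit Types (f g : seq 'I_N -> F) (s t : seq 'I_N) (c : bool) (w : seq letter).

(** The tensor power of the cup; it vanishes on words of odd length. *)
Fixpoint cups s : F :=
  match s with
  | [::] => 1
  | [:: a, b & t] => (a == b)%:R * cups t
  | _ => 0
  end.

Fixpoint cup (i : nat) f s {struct i} : F :=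
  match i, s with
  | 0%N, [:: a, b & t] => (a == b)%:R * f t
  | i'.+1, a :: t => cup i' (fun r => f (a :: r)) t
  | _, _ => 0
  end.

Fixpoint cap (i : nat) f s {struct i} : F :=
  match i, s with
  | 0%N, _ => trace2 f s
  | i'.+1, a :: t => cap i' (fun r => f (a :: r)) t
  | _, _ => 0
  end.

Lemma cup_cat i p f s : cup (size p + i) f (p ++ s) = cup i (fun t => f (p ++ t)) s.
Proof. by elim: p f => [|a p IH] f //=; rewrite IH. Qed.

Lemma cap_cat i p f s : cap (size p + i) f (p ++ s) = cap i (fun t => f (p ++ t)) s.
Proof. by elim: p f => [|a p IH] f //=; rewrite IH. Qed.

Lemma eq_cup i f g s : (forall t, (size t).+2 = size s -> f t = g t) ->
  cup i f s = cup i g s.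
Proof.
elim: i f g s => [|i IH] f g [|a s] //= efg.
  by case: s efg => [|b s] //= efg; rewrite efg.
by apply: IH => t st; apply: efg; rewrite /= st.
Qed.

Lemma eq_cap i f g s : (forall t, size t = (size s).+2 -> f t = g t) ->
  cap i f s = cap i g s.
Proof.
elim: i f g s => [|i IH] f g [|a s] //= efg; first 1 last.
- by apply: eq_bigr => x _; apply: efg.
- by apply: IH => t st; apply: efg; rewrite /= st.
by apply: eq_bigr => x _; apply: efg.
Qed.

Lemma cup_sum i (T : Type) (r : seq T) (P : pred T) (f : T -> seq 'I_N -> F) s :
  cup i (fun t => \sum_(m <- r | P m) f m t) s = \sum_(m <- r | P m) cup i (f m) s.
Proof.
elim: i f s => [|i IH] f [|a s] //=; [by rewrite big1 | | by rewrite big1].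
by case: s => [|b s] /=; [rewrite big1 | rewrite mulr_sumr].
Qed.

Lemma cap_sum i (T : Type) (r : seq T) (P : pred T) (f : T -> seq 'I_N -> F) s :
  cap i (fun t => \sum_(m <- r | P m) f m t) s = \sum_(m <- r | P m) cap i (f m) s.
Proof.
elim: i f s => [|i IH] f [|a s] //=; [exact: exchange_big | exact: exchange_big |].
by rewrite big1.
Qed.

Lemma cupZ i x f s : cup i (fun t => x * f t) s = x * cup i f s.
Proof.
elim: i f s => [|i IH] f [|a s] //=; rewrite ?mulr0 //.
by case: s => [|b s]; rewrite ?mulr0 // mulrCA.
Qed.

Lemma capZ i x f s : cap i (fun t => x * f t) s = x * cap i f s.
Proof.
by elim: i f s => [|i IH] f [|a s] //=; rewrite ?mulr0 // /trace2 mulr_sumr.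
Qed.

Lemma sum_tupleS k (G : seq 'I_N -> F) :
  \sum_(s : k.+1.-tuple 'I_N) G s = \sum_a \sum_(s : k.-tuple 'I_N) G (a :: s).
Proof.
rewrite pair_big /=.
rewrite (reindex (fun p : 'I_N * k.-tuple 'I_N => [tuple of p.1 :: p.2])) //=.
exists (fun t : k.+1.-tuple 'I_N => (thead t, [tuple of behead t])) => [[a s] _|s _] /=.
  by congr (_, _); apply: val_inj.
by rewrite [RHS]tuple_eta.
Qed.

Lemma sum_tuple0 (G : seq 'I_N -> F) : \sum_(s : 0.-tuple 'I_N) G s = G [::].
Proof.
rewrite (big_pred1 [tuple]) // => s.
by rewrite [s]tuple0; apply/esym/eqP.
Qed.

Definition pairing k f g : F := \sum_(s : k.-tuple 'I_N) f s * g s.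

Lemma eq_pairing k f f' g g' :
  (forall s, size s = k -> f s = f' s) -> (forall s, size s = k -> g s = g' s) ->
  pairing k f g = pairing k f' g'.
Proof. by move=> ef eg; apply: eq_bigr => s _; rewrite ef ?eg ?size_tuple. Qed.

Lemma pairingC k f g : pairing k f g = pairing k g f.
Proof. by apply: eq_bigr => s _; rewrite mulrC. Qed.

Lemma pairingS k f g : pairing k.+1 f g =
  \sum_a pairing k (fun s => f (a :: s)) (fun s => g (a :: s)).
Proof. exact: (sum_tupleS k (fun s => f s * g s)). Qed.

Lemma pairing0 f g : pairing 0 f g = f [::] * g [::].
Proof. exact: (sum_tuple0 (fun s => f s * g s)). Qed.

Lemma pairing_cup k i f g : pairing k.+2 (cup i f) g = pairing k f (cap i g).
Proof.
elim: i k f g => [|i IH] k f g.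
  rewrite pairingS /=; under eq_bigr do rewrite pairingS /pairing /=.
  rewrite /pairing /trace2; under [RHS]eq_bigr do rewrite mulr_sumr.
  rewrite [RHS]exchange_big; apply: eq_bigr => a _ /=.
  rewrite exchange_big; apply: eq_bigr => s _ /=.
  under eq_bigr do rewrite -mulrA.
  by rewrite sum_delta.
rewrite pairingS; case: k => [|k].
  rewrite pairing0 /= mulr0 big1 // => a _.
  rewrite /pairing big1 // => -[[|b [|d s]] sz] _ //=.
  by case: i {IH} => [|[|i]] /=; rewrite mul0r.
by rewrite [RHS]pairingS; apply: eq_bigr => a _; apply: IH.
Qed.

Variable h : 'I_N -> 'I_N -> F.
Local Notation gate := (gate h).

Lemma pairing_gate k c i f g : pairing k (gate c i f) g = pairing k f (gate c i g).
Proof.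
elim: i k f g => [|i IH] [|k] f g; rewrite ?pairingS.
- by rewrite !pairing0 /= mul0r mulr0.
- case: k => [|k].
    by rewrite !big1 // => a _; rewrite pairing0 /= ?mul0r ?mulr0.
  have half f' g' : pairing k.+2 (gate c 0 f') g' = weight F N c ^- 2 *
      \sum_(s : k.-tuple 'I_N) \sum_j project h c j f' s * project h c j g' s.
    rewrite pairingS; under eq_bigr do rewrite pairingS.
    under eq_bigr do rewrite exchange_big /=.
    rewrite exchange_big mulr_sumr /=; apply: eq_bigr => s _.
    rewrite mulr_sumr.
    under eq_bigr do under eq_bigr do rewrite mulr_sumr mulr_suml.
    under eq_bigr do rewrite exchange_big /=.
    rewrite exchange_big /=; apply: eq_bigr => j _.
    rewrite {3}/project mulr_sumr mulr_sumr; apply: eq_bigr => a _.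
    by rewrite !mulr_sumr; apply: eq_bigr => b _; ring.
  have := half f g; rewrite pairingS => ->; rewrite -pairingS pairingC half.
  by congr (_ * _); apply: eq_bigr => s _; apply: eq_bigr => j _; rewrite mulrC.
- by rewrite !pairing0 /= mul0r mulr0.
by apply: eq_bigr => a _; apply: IH.
Qed.

Definition act w f : seq 'I_N -> F := foldr (fun x g => gate (colour x) x.2 g) f w.

Lemma act_cat u v f : act (u ++ v) f = act u (act v f).
Proof. exact: foldr_cat. Qed.

Lemma eq_act w f g s :
  (forall t, size t = size s -> f t = g t) -> act w f s = act w g s.
Proof.
elim: w s => [|x w IH] s efg /=; first exact: efg.
by apply: eq_gate => t st; apply: IH => r rt; apply: efg; rewrite rt.
Qed.

Lemma actZ w x f s : act w (fun t => x * f t) s = x * act w f s.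
Proof.
elim: w s => [|y w IH] s //=; rewrite -gateZ.
by apply: eq_gate => t _; apply: IH.
Qed.

Lemma act_shift2 w f a b s :
  act (shift2 w) f [:: a, b & s] = act w (fun t => f [:: a, b & t]) s.
Proof.
elim: w s => [|x w IH] s //=; rewrite /colour /= negbK.
by apply: eq_gate => t _; apply: IH.
Qed.

Lemma pairing_act k w f g : pairing k (act w f) g = pairing k f (act (rev w) g).
Proof.
elim: w f g => [|x w IH] f g //=.
by rewrite pairing_gate IH rev_cons -cats1 act_cat.
Qed.

Hypothesis N_gt0 : (0 < N)%N.
Hypothesis hh : sign_hadamard h.

Lemma gate_idem c i f s : gate c i (gate c i f) s = gate c i f s.
Proof.
elim: i f s => [|i IH] f [|a s] //; last exact: IH.
exact: gate_idem0.
Qed.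

Lemma gate_mixedC c i f s :
  gate c i (gate (~~ c) i f) s = gate (~~ c) i (gate c i f) s.
Proof.
elim: i f s => [|i IH] f [|a s] //; last exact: IH.
exact: gate_mixedC0.
Qed.

Lemma gate_sameC c i f s :
  gate c i (gate c i.+1 f) s = gate c i.+1 (gate c i f) s.
Proof.
elim: i f s => [|i IH] f [|a s] //; last exact: IH.
exact: gate_sameC0.
Qed.

Lemma gate_farC c c' i j f s : (i.+1 < j)%N ->
  gate c i (gate c' j f) s = gate c' j (gate c i f) s.
Proof.
elim: i j f s => [|i IH] [|[|j]] f [|a s] ij //; last exact: (IH j.+1 (fun r => f (a :: r)) s ij).
case: s => [|b s] //; rewrite gate0E !gateSE.
rewrite (gateZ h c' j (weight F N c ^- 2)
  (fun r => \sum_m base h c m a * base h c m b * project h c m f r)) gate_sum.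
congr (_ * _); apply: eq_bigr => m _; rewrite gateZ; congr (_ * _).
rewrite gate_sum; apply: eq_bigr => x _; rewrite gate_sum; apply: eq_bigr => y _.
by rewrite gateZ.
Qed.

Lemma gate_braid c i f s : (i.+2 < size s)%N ->
  gate c i (gate (~~ c) i.+1 (gate c i f)) s = N%:R^-1 * gate c i f s.
Proof.
elim: i f s => [|i IH] f [|a s] sz //; last exact: IH.
case: s sz => [|b [|d s]] _ //; rewrite !gate0E mulrCA; congr (_ * _).
rewrite mulr_sumr; apply: eq_bigr => j _; rewrite mulrCA; congr (_ * _).
exact: project_braid.
Qed.

Lemma gate_braid_succ c i f s : (i.+2 < size s)%N ->
  gate c i.+1 (gate (~~ c) i (gate c i.+1 f)) s = N%:R^-1 * gate c i.+1 f s.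
Proof.
elim: i f s => [|i IH] f [|a s] sz //; last exact: IH.
case: s sz => [|b [|d s]] _ //; rewrite !gateSE !gate0E mulrCA; congr (_ * _).
rewrite mulr_sumr; apply: eq_bigr => j _; rewrite mulrCA; congr (_ * _).
exact: project_braid_succ.
Qed.

Lemma act_commuting x y f s : commuting x y -> act [:: x; y] f s = act [:: y; x] f s.
Proof.
case: x y => [b i] [b' j]; rewrite /commuting /colour /= => /or3P[nb|ij|ji]; first 1 last.
- exact: gate_farC.
- by apply/esym; apply: gate_farC.
have [ij|ji|eij] := ltngtP i j.
- have [ij1|] := ltnP i.+1 j; first exact: gate_farC.
  move=> ji1; have -> : j = i.+1 by lia.
  have <- : colour (b, i) = colour (b', i.+1) by rewrite /colour; move: nb => /=; case: b b' (odd i) => [] [] [].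
  exact: gate_sameC.
- have [ij1|] := ltnP j.+1 i; first by apply/esym; exact: gate_farC.
  move=> ji1; have -> : i = j.+1 by lia.
  have -> : colour (b, j.+1) = colour (b', j) by rewrite /colour; move: nb => /=; case: b b' (odd j) => [] [] [].
  by apply/esym; exact: gate_sameC.
rewrite -eij; have -> : colour (b', i) = ~~ colour (b, i).
  by rewrite /colour; move: nb => /=; case: b b' (odd i) => [] [] [].
exact: gate_mixedC.
Qed.

Lemma act_neighbours k x y f s : fits k x -> fits k y -> neighbours x y ->
  size s = k -> act [:: x; y; x] f s = N%:R^-1 * act [:: x] f s.
Proof.
case: x y => [b i] [b' j]; rewrite /fits /neighbours /colour /=.
move=> fx fy /andP[/eqP<- /orP[/eqP ej|/eqP ei]] sk.
  have -> : colour (b, j) = ~~ colour (b, i) by rewrite /colour -ej /= addbN.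
  by rewrite -ej; apply: gate_braid; lia.
have -> : colour (b, j) = ~~ colour (b, i) by rewrite /colour -ei /= addbN negbK.
by rewrite -ei; apply: gate_braid_succ; lia.
Qed.

(** One derivation serves all Hadamard matrices of size [N] at once; this is how the
inner products for two of them come to be compared. *)
Lemma red_act k (y : F) u v : tl_red N%:R k y u v ->
  forall f s, size s = k -> act u f s = y * act v f s.
Proof.
elim=> {y u v} [w|a b u v w _ IH1 _ IH2|a p q u v _ IH|x|x y cxy|x y fx fy nxy] f s sk.
- by rewrite mul1r.
- by rewrite IH1 // IH2 // mulrA.
- rewrite !act_cat -actZ; apply: eq_act => t st.
  by apply: IH; rewrite st.
- by rewrite mul1r; apply: gate_idem.
- by rewrite mul1r; apply: act_commuting.
exact: (act_neighbours (k := k)).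
Qed.

Lemma gate_mixed_cups c s : (1 < size s)%N -> gate c 0 (gate (~~ c) 0 cups) s = cups s.
Proof.
case: s => [|a [|b s]] // _; rewrite (gate_mixed N_gt0 hh) /trace2 /=.
under eq_bigr do rewrite eqxx mul1r.
rewrite sumr_const card_ord -mulr_natl.
by have := N_neq0 F N_gt0 => n0; field.
Qed.

Lemma trace2_gate_mixed c f s : trace2 (gate c 0 (gate (~~ c) 0 f)) s = trace2 f s.
Proof.
rewrite {1}/trace2; under eq_bigr do rewrite (gate_mixed N_gt0 hh) eqxx mul1r.
rewrite sumr_const card_ord -mulr_natl.
by have := N_neq0 F N_gt0 => n0; field.
Qed.

(** A cup is moved one site to the right by projecting onto the cup at the new
position: this is the zigzag identity, and it reduces all cups to the one at the
front. *)
Lemma cupS c i f s : (i.+2 < size s)%N ->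
  cup i.+1 f s = N%:R * gate c i.+1 (gate (~~ c) i.+1 (cup i f)) s.
Proof.
elim: i f s => [|i IH] f [|a s] sz //; last exact: IH.
case: s sz => [|b [|d s]] _ //.
rewrite !gateSE (gate_mixed N_gt0 hh c (fun r => cup 0 f (a :: r))) mulrA mulfV ?N_neq0 // mul1r /=.
by congr (_ * _); rewrite /trace2 /= sum_delta.
Qed.

Lemma capS c i f s : (i < size s)%N ->
  cap i.+1 f s = N%:R * cap i (gate c i.+1 (gate (~~ c) i.+1 f)) s.
Proof.
elim: i f s => [|i IH] f [|a s] sz //; last exact: IH.
change (trace2 (fun r => f (a :: r)) s =
  N%:R * \sum_x gate c 1 (gate (~~ c) 1 f) [:: x, x, a & s]).
rewrite mulr_sumr (eq_bigr (fun x => (x == a)%:R * trace2 (fun r => f (x :: r)) s)) ?sum_deltar // => x _.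
rewrite gateSE (gate_mixed N_gt0 hh c (fun r => f (x :: r))).
by rewrite mulrA mulfV ?N_neq0 // mul1r.
Qed.

End Positions.

(** * Partial isometries between families with equal Gram matrices *)

Section Isometry.
Variable F : realFieldType.

Lemma row_norm_eq0 n (v : 'rV[F]_n) : v *m v^T = 0 -> v = 0.
Proof.
move/matrixP/(_ 0 0); rewrite !mxE => v0; apply/rowP=> i; rewrite mxE.
have sq j : true -> 0 <= v 0 j * v^T j 0 by rewrite mxE -expr2 sqr_ge0.
have : v 0 i * v^T i 0 = 0 := psumr_eq0P sq v0 isT.
by rewrite mxE -expr2 => /eqP; rewrite sqrf_eq0 => /eqP.
Qed.

(** Over an ordered field a matrix and its Gram matrix have the same rank, hence the
same column space. *)
Lemma trmx_sub_gram m n (G : 'M[F]_(m, n)) : (G^T <= G *m G^T)%MS.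
Proof.
have le := submxMl G G^T.
rewrite -(geq_leqif (mxrank_leqif_sup le)) mxrank_tr.
rewrite -(mxrank_mul_ker G G^T).
suff -> : (G :&: kermx G^T)%MS = 0 by rewrite mxrank0 addn0.
apply/eqP; rewrite -submx0; apply/rV_subP=> v.
rewrite sub_capmx => /andP[/submxP[y ey] /sub_kermxP vG].
suff -> : v = 0 by rewrite sub0mx.
by apply: row_norm_eq0; rewrite {2}ey trmx_mul mulmxA vG mul0mx.
Qed.

Variable T : finType.

Definition row_of (v : T -> F) : 'rV[F]_#|T| := \row_i v (enum_val i).

Lemma sum_enum_val (G : T -> F) : \sum_(i < #|T|) G (enum_val i) = \sum_t G t.
Proof. by rewrite -(big_enum_val G); apply: eq_bigl. Qed.

Lemma row_of_dot (u v : T -> F) : (row_of u *m (row_of v)^T) 0 0 = \sum_t u t * v t.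
Proof.
by rewrite mxE -(sum_enum_val (fun t => u t * v t)); apply: eq_bigr => i _; rewrite !mxE.
Qed.

(** An infinite family of row vectors is spanned by finitely many of its members:
take as many as give the largest possible rank. *)
Lemma exists_spanning_rows (W : Type) (D : W -> Prop) n (r : W -> 'rV[F]_n) :
  exists m (ws : 'I_m -> W), (forall i, D (ws i)) /\
    forall w, D w -> (r w <= \matrix_i r (ws i))%MS.
Proof.
pose Q q := `[< exists m (ws : 'I_m -> W),
  (forall i, D (ws i)) /\ \rank (\matrix_i r (ws i)) = q >].
have Q0 : exists q, Q q.
  exists 0%N; apply/asboolP; exists 0%N, (fun i : 'I_0 => False_rect W (notF (ltn_ord i))).
  by split=> [[]//|]; rewrite flatmx0 mxrank0.
have Qn q : Q q -> (q <= n)%N.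
  by move/asboolP=> [m [ws [_ <-]]]; apply: rank_leq_col.
case: (ex_maxnP Q0 Qn) => q /asboolP[m [ws [Dws rq]]] maxq.
exists m, ws; split=> // w Dw.
(* adding [w] to the list cannot increase the rank *)
pose ws' (i : 'I_(m + 1)) := if split i is inl j then ws j else w.
have sub : (\matrix_i r (ws i) <= \matrix_i r (ws' i))%MS.
  apply/row_subP=> i; have <- : row (lshift 1 i) (\matrix_i r (ws' i)) = row i (\matrix_i r (ws i)).
    by apply/rowP=> j; rewrite !mxE /ws' (unsplitK (inl i)).
  exact: row_sub.
have Qw : Q (\rank (\matrix_i r (ws' i))).
  apply/asboolP; exists (m + 1)%N, ws'; split=> // i.
  by rewrite /ws'; case: split.
have := maxq _ Qw; rewrite -rq (geq_leqif (mxrank_leqif_sup sub)).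
apply: submx_trans.
have <- : row (rshift m 0) (\matrix_i r (ws' i)) = r w.
  by apply/rowP=> j; rewrite !mxE /ws' (unsplitK (inr 0)).
exact: row_sub.
Qed.

(** Let [A] and [B] hold finitely many members of the two families that span all
the others at the same time.  Since [A A^T = B B^T], a solution [Z] of
[B B^T Z = B] yields the operator [A^T Z], which sends the rows of [A] to those of
[B] and annihilates the orthogonal complement.  The last clause is the existence of
the orthogonal projection onto the span of the first family. *)
Lemma exists_partial_isometry (W : Type) (D : W -> Prop) (f g : W -> T -> F) :
  (forall u w, D u -> D w -> \sum_t f u t * f w t = \sum_t g u t * g w t) ->
  exists p : T -> T -> F,
  [/\ forall w, D w -> forall t, \sum_s f w s * p s t = g w t,
      forall v, (forall w, D w -> \sum_s v s * f w s = 0) ->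
        forall t, \sum_s v s * p s t = 0
    & forall v, exists m (y : 'I_m -> F) (ws : 'I_m -> W),
        (forall i, D (ws i)) /\
        forall w, D w -> \sum_s (v s - \sum_i y i * f (ws i) s) * f w s = 0].
Proof.
move=> gram.
have [m [ws [Dws span]]] :=
  exists_spanning_rows D (fun w => row_mx (row_of (f w)) (row_of (g w))).
pose A := \matrix_i row_of (f (ws i)); pose B := \matrix_i row_of (g (ws i)).
have eAB : \matrix_i row_mx (row_of (f (ws i))) (row_of (g (ws i))) = row_mx A B.
  apply/matrixP=> i j; rewrite !mxE; case: split => j'; by rewrite !mxE.
have coords w : D w -> exists y, row_of (f w) = y *m A /\ row_of (g w) = y *m B.
  move=> /span; rewrite eAB => /submxP[y]; rewrite mul_mx_row => /eq_row_mx[fy gy].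
  by exists y.
have gramAB : A *m A^T = B *m B^T.
  have entry (q : W -> T -> F) (C := \matrix_i row_of (q (ws i))) i j :
      (C *m C^T) i j = \sum_t q (ws i) t * q (ws j) t.
    by rewrite -row_of_dot !mxE; apply: eq_bigr => l _; rewrite !mxE.
  by apply/matrixP=> i j; rewrite !entry gram.
have [Z eZ] := submxP (trmx_sub_gram B).
have {}eZ : B *m B^T *m Z^T = B.
  by apply: trmx_inj; rewrite trmx_mul trmxK trmx_mul trmxK -eZ.
pose P := A^T *m Z^T.
exists (fun s t => P (enum_rank s) (enum_rank t)).
have act (v : T -> F) t : \sum_s v s * P (enum_rank s) (enum_rank t) =
    (row_of v *m P) 0 (enum_rank t).
  rewrite mxE -sum_enum_val; apply: eq_bigr => i _.
  by rewrite !mxE enum_valK.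
split.
- move=> w Dw t; have [y [fy gy]] := coords w Dw.
  rewrite act fy mulmxA -[y *m A *m _]mulmxA gramAB -mulmxA eZ -gy mxE.
  by rewrite enum_rankK.
- move=> v vf t; rewrite act mulmxA.
  suff -> : row_of v *m A^T = 0 by rewrite mul0mx mxE.
  apply/rowP=> j; rewrite [RHS]mxE -(vf _ (Dws j)) -row_of_dot !mxE.
  by apply: eq_bigr => i _; rewrite !mxE.
move=> v; have /submxP[y ey] : (row_of v *m A^T <= A *m A^T)%MS.
  exact: submx_trans (submxMl _ _) (trmx_sub_gram A).
exists m, (fun i => y 0 i), ws; split=> // w Dw.
have [z [fz _]] := coords w Dw.
pose u s := v s - \sum_i y 0 i * f (ws i) s.
have -> : \sum_s (v s - \sum_i y 0 i * f (ws i) s) * f w s = \sum_s u s * f w s by [].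
rewrite -row_of_dot fz trmx_mul mulmxA.
suff -> : row_of u = row_of v - y *m A by rewrite mulmxBl ey mulmxA subrr mul0mx mxE.
by apply/rowP=> j; rewrite !mxE; congr (_ - _); apply: eq_bigr => i _; rewrite !mxE.
Qed.

End Isometry.

(** * The intertwiner of two Hadamard matrices of the same size *)

Section Transport.
Variables (F : realFieldType) (N : nat).
Local Notation cups := (@cups F N).
Hypothesis N_gt0 : (0 < N)%N.
Implicit Types (f g : seq 'I_N -> F) (s t : seq 'I_N) (c : bool) (w : seq letter).
Implicit Types (h : 'I_N -> 'I_N -> F).

(** The invariant tensors of [h], up to linear combinations. *)
Definition vec h w : seq 'I_N -> F := act h w cups.

Lemma vec_letter h c i w : vec h ((c (+) odd i, i) :: w) = gate h c i (vec h w).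
Proof. by rewrite /vec /act /= /colour addbK. Qed.

(** The operation [O] sends invariant tensors to invariant tensors, and does so by
the same word and the same scalar for all Hadamard matrices. *)
Definition preserves (k l : nat)
    (O : ('I_N -> 'I_N -> F) -> (seq 'I_N -> F) -> seq 'I_N -> F) : Prop :=
  forall w, all (fits k) w -> exists (y : F) w', all (fits l) w' /\
    forall h, sign_hadamard h -> forall s, size s = l ->
      O h (vec h w) s = y * vec h w' s.

Lemma preserves_gate k c i : (i.+1 < k)%N -> preserves k k (fun h => gate h c i).
Proof.
move=> ik w fw; exists 1, ((c (+) odd i, i) :: w); split; first by rewrite /= fw andbT.
by move=> h _ s _; rewrite mul1r vec_letter.
Qed.

(** Both the cups and the cap absorb the projection onto the cup at the first two
sites, which can therefore be put on both sides of the word [w]. *)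
Lemma preserves_trace2 k : preserves k.+2 k (fun=> @trace2 F N).
Proof.
move=> w fw; have [w3 [y r3] a3] := reduces_double_sandwich (N%:R : F) (isT : 1 < k.+2)%N fw.
exists (y * N%:R), [seq (x.1, x.2.-2) | x <- w3]; split.
  rewrite all_map; apply: sub_all a3 => x /andP[]; rewrite /fits /=; lia.
move=> h hh s sk; set w' := [seq _ | x <- w3].
have e3 : w3 = shift2 w'.
  rewrite /w' /shift2 -map_comp -[LHS]map_id; apply/eq_in_map => x /(allP a3).
  by case: x => b [|[|i]].
(* these two letters multiply to the projection onto the first cup *)
pose E := [:: (true, 0%N); (false, 0%N)].
have Ecups t : size t = k.+2 -> act h E cups t = cups t.
  by move=> tk; rewrite -[RHS](gate_mixed_cups N_gt0 hh true) ?tk.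
transitivity (trace2 (act h (E ++ w ++ E) cups) s).
  rewrite act_cat (trace2_gate_mixed N_gt0 hh true); apply: eq_bigr => a _.
  by rewrite act_cat; apply: eq_act => t tk; rewrite Ecups // tk /= sk.
rewrite /trace2 (eq_bigr (fun=> y * vec h w' s)).
  by rewrite sumr_const card_ord -mulr_natl; ring.
move=> a _; rewrite (red_act N_gt0 hh r3) /= ?sk // act_cat; congr (_ * _).
rewrite (eq_act _ _ (g := cups)); last by move=> t tk; rewrite Ecups // tk /= sk.
rewrite e3 act_shift2; apply: eq_act => t _ /=.
by rewrite eqxx mul1r.
Qed.

(** Away from the front, a cup is a multiple of a pair of gates applied to the
preceding cup, by [cupS]. *)
Lemma preserves_cup k i : (i <= k)%N -> preserves k k.+2 (fun=> @cup F N i).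
Proof.
elim: i => [|i IH] ik w fw.
  exists 1, (shift2 w); split.
    by rewrite all_map; apply: sub_all fw.
  move=> h hh [|a [|b s]] // _; rewrite mul1r /vec act_shift2 /=.
  by rewrite -actZ; apply: eq_act.
have [y [w' [f' e']]] := IH (ltnW ik) w fw.
exists (N%:R * y), [:: (true (+) odd i.+1, i.+1), (false (+) odd i.+1, i.+1) & w']; split.
  by rewrite /= f' /fits /= !ltnS ik.
move=> h hh s sk; rewrite (cupS N_gt0 hh true) ?sk; last by lia.
rewrite -mulrA; congr (_ * _); rewrite !vec_letter.
rewrite -gateZ; apply: eq_gate => t st; rewrite -gateZ; apply: eq_gate => r rt.
by rewrite e' // rt st sk.
Qed.

Lemma preserves_cap k i : (i <= k)%N -> preserves k.+2 k (fun=> @cap F N i).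
Proof.
elim: i => [|i IH] ik w fw.
  exact: preserves_trace2.
set x := (true (+) odd i.+1, i.+1); set z := (false (+) odd i.+1, i.+1).
have fxz : all (fits k.+2) [:: x, z & w] by rewrite /= fw /fits /= !ltnS ik.
have [y [w' [f' e']]] := IH (ltnW ik) _ fxz; exists (N%:R * y), w'; split=> // h hh s sk.
rewrite (capS N_gt0 hh true) ?sk // -mulrA -e' //; congr (_ * _).
by rewrite !vec_letter.
Qed.

(** The first cup on the left-hand side becomes a cap on the right-hand side, which
lowers the number of sites by two. *)
Lemma pairing_cups_vec k w : all (fits k) w -> forall h h',
  sign_hadamard h -> sign_hadamard h' ->
  pairing k cups (vec h w) = pairing k cups (vec h' w).
Proof.
elim/ltn_ind: k w => k IH w fw h h' hh hh'; case: k IH fw => [|[|k]] IH fw.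
- by case: w fw.
- by case: w fw.
have cupE s : size s = k.+2 -> cups s = cup 0 cups s by case: s => [|a [|b s]].
have [y [w' [f' e']]] := preserves_cap (leq0n k) fw.
have step (g : 'I_N -> 'I_N -> F) : sign_hadamard g ->
    pairing k.+2 cups (vec g w) = pairing k cups (fun s => y * vec g w' s).
  move=> gg; rewrite (eq_pairing cupE (fun _ _ => erefl)) pairing_cup.
  by apply: eq_pairing => // s sk; rewrite e'.
have scale (g : 'I_N -> 'I_N -> F) : pairing k cups (fun s => y * vec g w' s) = y * pairing k cups (vec g w').
  by rewrite /pairing mulr_sumr; apply: eq_bigr => s _; rewrite mulrCA.
by rewrite !step // !scale (IH k _ w' f' h h').
Qed.

(** Gates are self-adjoint, so that all letters can be moved to one side of the inner
product. *)
Lemma pairing_vec k u w h h' : all (fits k) u -> all (fits k) w ->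
  sign_hadamard h -> sign_hadamard h' ->
  pairing k (vec h u) (vec h w) = pairing k (vec h' u) (vec h' w).
Proof.
move=> fu fw hh hh'; rewrite /vec !pairing_act -!act_cat.
by apply: pairing_cups_vec; rewrite // all_cat all_rev fu.
Qed.

Definition transports h h' k (p : seq 'I_N -> seq 'I_N -> F) : Prop :=
  [/\ forall w, all (fits k) w -> forall t, size t = k ->
        pairing k (vec h w) (fun s => p s t) = vec h' w t,
      forall f, (forall w, all (fits k) w -> pairing k f (vec h w) = 0) ->
        forall t, size t = k -> pairing k f (fun s => p s t) = 0
    & forall f, exists m (y : 'I_m -> F) (ws : 'I_m -> seq letter),
        (forall i, all (fits k) (ws i)) /\
        forall w, all (fits k) w ->
          pairing k (fun s => f s - \sum_i y i * vec h (ws i) s) (vec h w) = 0].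

Lemma exists_transport h h' k : sign_hadamard h -> sign_hadamard h' ->
  exists p, transports h h' k p.
Proof.
move=> hh hh'.
have gram u w : all (fits k) u -> all (fits k) w ->
    \sum_(t : k.-tuple 'I_N) vec h u t * vec h w t =
    \sum_(t : k.-tuple 'I_N) vec h' u t * vec h' w t.
  by move=> fu fw; apply: pairing_vec.
have [p [pa pb pc]] := exists_partial_isometry
  (D := all (fits k)) (f := fun w (t : k.-tuple 'I_N) => vec h w t)
  (g := fun w (t : k.-tuple 'I_N) => vec h' w t) gram.
(* [0] is the value on words that are not of length [k] *)
pose q s t := if (insub s, insub t) is (Some x, Some z) then p x z else 0.
have qE (s t : k.-tuple 'I_N) : q s t = p s t by rewrite /q !valK.
exists q; split.
- move=> w fw t tk; have := pa w fw (tcast tk (in_tuple t)).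
  rewrite val_tcast /= => <-; apply: eq_bigr => s _.
  by rewrite -qE val_tcast.
- move=> f fo t tk; have := pb (fun x : k.-tuple 'I_N => f x) fo (tcast tk (in_tuple t)) => <-.
  by apply: eq_bigr => s _; rewrite -qE val_tcast.
by move=> f; apply: (pc (fun x : k.-tuple 'I_N => f x)).
Qed.

Definition dirac s : seq 'I_N -> F := fun r => (r == s)%:R.

Lemma pairing_dirac k s g : size s = k -> pairing k (dirac s) g = g s.
Proof.
move=> sk; have [x ex] : exists x : k.-tuple 'I_N, val x = s.
  by exists (tcast sk (in_tuple s)); rewrite /= val_tcast.
rewrite /pairing (bigD1 x) //= /dirac -{1 2 3}ex eqxx mul1r.
rewrite big1 ?addr0 -?ex // => z; rewrite -val_eqE /= => /negPf->.
by rewrite mul0r.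
Qed.

Lemma pairing_split k f g m (y : 'I_m -> F) (v : 'I_m -> seq 'I_N -> F) :
  pairing k f g = \sum_i y i * pairing k (v i) g +
    pairing k (fun s => f s - \sum_i y i * v i s) g.
Proof.
rewrite /pairing; under [X in _ = X + _]eq_bigr do rewrite mulr_sumr.
rewrite exchange_big -big_split /=; apply: eq_bigr => s _.
rewrite mulrBl mulr_suml addrC; under [X in _ + X]eq_bigr do rewrite mulrA.
by rewrite subrK.
Qed.

(** Decompose the basis vector at [s] into an invariant part and a part [f] that
is orthogonal to all invariant tensors.  On the first part both sides act by the
same words.  The second part is annihilated by [p], and [O] sends it to a tensor
which is again orthogonal to the invariants, because the adjoint [Oa] preserves
them. *)
Lemma transport_intertwines h h' k l O Oa p q :
  sign_hadamard h -> sign_hadamard h' ->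
  transports h h' k p -> transports h h' l q ->
  preserves k l O -> preserves l k Oa ->
  (forall f g, pairing l (O h f) g = pairing k f (Oa h g)) ->
  (forall f g t, size t = l -> (forall r, size r = k -> f r = g r) ->
    O h' f t = O h' g t) ->
  (forall m (v : 'I_m -> seq 'I_N -> F) t,
    O h' (fun r => \sum_i v i r) t = \sum_i O h' (v i) t) ->
  (forall x f t, O h' (fun r => x * f r) t = x * O h' f t) ->
  forall s t, size s = k -> size t = l ->
  Oa h (fun r => q r t) s = O h' (p s) t.
Proof.
move=> hh hh' [pa pb pc] [qa qb _] pO pOa adj eO sumO scaleO s t sk tl.
have [m [y [ws [fws orth]]]] := pc (dirac s).
set f := (fun r => _ - _) in orth.
(* the left-hand side is the value at the basis vector [dirac s] *)
rewrite -(pairing_dirac _ sk) (pairing_split _ _ _ y (fun i => vec h (ws i))).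
rewrite -/f -adj qb // ?addr0; last first.
  move=> w fw; rewrite adj; have [z [w' [f' e']]] := pOa w fw.
  rewrite (eq_pairing (g' := fun r => z * vec h w' r) (fun _ _ => erefl)); last exact: e'.
  have := orth w' f'; rewrite /pairing => o.
  by under eq_bigr do rewrite mulrCA; rewrite -mulr_sumr o mulr0.
rewrite (eO _ (fun r => \sum_i y i * vec h' (ws i) r) _ tl); last first.
  move=> r rk; rewrite -[LHS](pairing_dirac (fun s => p s r) sk).
  rewrite (pairing_split _ _ _ y (fun i => vec h (ws i))) pb // addr0.
  by apply: eq_bigr => i _; rewrite pa.
rewrite sumO; apply: eq_bigr => i _; rewrite scaleO; congr (_ * _).
have [z [w' [f' e']]] := pO _ (fws i).
rewrite e' // -adj (eq_pairing (f' := fun r => z * vec h w' r) (g' := fun r => q r t)) //; last exact: e'.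
by rewrite -(qa w' f' t tl) /pairing mulr_sumr; apply: eq_bigr => r _; rewrite mulrA.
Qed.

Theorem exists_intertwiner h h' : sign_hadamard h -> sign_hadamard h' ->
  exists p : seq 'I_N -> seq 'I_N -> F,
  [/\ p [::] [::] = 1,
      forall c i s t, size s = size t -> (i.+1 < size s)%N ->
        gate h c i (fun r => p r t) s = gate h' c i (p s) t,
      forall i s t, size t = (size s).+2 -> (i <= size s)%N ->
        cap i (fun r => p r t) s = cup i (p s) t
    & forall i s t, size s = (size t).+2 -> (i <= size t)%N ->
        cup i (fun r => p r t) s = cap i (p s) t].
Proof.
move=> hh hh'; have [P PP] := choice (fun k => exists_transport k hh hh').
exists (fun s t => P (size s) s t); split.
- have [pa _ _] := PP 0%N; have := pa [::] isT [::] erefl.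
  by rewrite pairing0 /vec /= mul1r.
- move=> c i s t st ik.
  rewrite (eq_gate _ _ _ (g := fun r => P (size s) r t)); last by move=> r ->.
  apply: (transport_intertwines (k := size s) (l := size s) (O := fun h => gate h c i)
     (Oa := fun h => gate h c i) hh hh' (PP _) (PP _)) => //; try exact: preserves_gate.
  + by move=> f g; apply: pairing_gate.
  + by move=> f g r rs efg; apply: eq_gate => z zr; apply: efg; rewrite zr.
  + by move=> m v r; apply: gate_sum.
  + by move=> x f r; apply: gateZ.
- move=> i s t st ik.
  rewrite (eq_cap _ (g := fun r => P (size s).+2 r t)); last by move=> r ->.
  apply: (transport_intertwines (k := size s) (l := (size s).+2) (O := fun=> @cup F N i)
     (Oa := fun=> @cap F N i) hh hh' (PP _) (PP _)) => //.
  + exact: preserves_cup.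
  + exact: preserves_cap.
  + by move=> f g; apply: pairing_cup.
  + by move=> f g r rs efg; apply: eq_cup => z zr; apply: efg; move: zr; rewrite rs => -[].
  + by move=> m v r; apply: cup_sum.
  + by move=> x f r; apply: cupZ.
move=> i s t st ik.
rewrite (eq_cup _ (g := fun r => P (size t) r t)); last first.
  by move=> r; rewrite st => -[->].
apply: (transport_intertwines (k := size s) (l := size t) (O := fun=> @cap F N i)
   (Oa := fun=> @cup F N i) hh hh' (PP _) (PP _)) => //; rewrite ?st.
+ exact: preserves_cap.
+ exact: preserves_cup.
+ by move=> f g; rewrite pairingC -pairing_cup pairingC.
+ by move=> f g r rs efg; apply: eq_cap => z zr; apply: efg; rewrite zr rs.
+ by move=> m v r; apply: cap_sum.
+ by move=> x f r; apply: capZ.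
Qed.

End Transport.

(** * A functional on words that respects the defining relations *)

Section Functional.
Variables (F : realFieldType) (N : nat) (h k : 'I_N -> 'I_N -> F).
Implicit Types (u v w : seq ('I_N * 'I_N)) (phi : seq ('I_N * 'I_N) -> F).

(** For a functional evaluated around the middle of a word, this is its value at the
product of two entries of [k^T x h], at [(m, l)] and [(m', l')], when [c] is
[true], and of two entries of [x] itself when [c] is [false]. *)
Definition contracted c (l l' m m' : 'I_N) (q : 'I_N -> 'I_N -> 'I_N -> 'I_N -> F) : F :=
  \sum_i \sum_i' base k c m i * base k c m' i' *
    \sum_j \sum_j' base h c l j * base h c l' j' * q i j i' j'.

(** The first two clauses say that [x] is orthogonal.  The last one says that
distinct entries in a row or in a column multiply to zero, for [x] and for its
transport by the two Hadamard matrices. *)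
Definition respects_relations phi : Prop :=
  forall u v,
  [/\ forall i i', \sum_j phi (u ++ [:: (i, j); (i', j)] ++ v) = (i == i')%:R * phi (u ++ v),
      forall j j', \sum_i phi (u ++ [:: (i, j); (i, j')] ++ v) = (j == j')%:R * phi (u ++ v)
    & forall c l l' m m', (l == l') != (m == m') ->
        contracted c l l' m m' (fun i j i' j' => phi (u ++ [:: (i, j); (i', j')] ++ v)) = 0].

Lemma respects_rev phi : respects_relations phi ->
  respects_relations (fun w => phi (rev w)).
Proof.
move=> rphi u v; have [r1 r2 r3] := rphi (rev v) (rev u).
have e x y : rev (u ++ [:: x; y] ++ v) = rev v ++ [:: y; x] ++ rev u.
  by rewrite !rev_cat -catA.
split=> [i i'|j j'|c l l' m m' lm].
- by under eq_bigr do rewrite e; rewrite r1 rev_cat eq_sym.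
- by under eq_bigr do rewrite e; rewrite r2 rev_cat eq_sym.
have := r3 c l' l m' m; rewrite [l' == l]eq_sym [m' == m]eq_sym => /(_ lm) <-.
rewrite [LHS]exchange_big; apply: eq_bigr => i _; apply: eq_bigr => i' _.
rewrite [base _ _ m _ * _]mulrC; congr (_ * _).
rewrite [LHS]exchange_big; apply: eq_bigr => j _; apply: eq_bigr => j' _.
by rewrite e [base _ _ l _ * _]mulrC.
Qed.

Lemma respects_add phi psi x y : respects_relations phi -> respects_relations psi ->
  respects_relations (fun w => x * phi w + y * psi w).
Proof.
move=> rphi rpsi u v; have [p1 p2 p3] := rphi u v; have [q1 q2 q3] := rpsi u v.
split=> [i i'|j j'|c l l' m m' lm].
- by rewrite big_split -!mulr_sumr p1 q1 /=; ring.
- by rewrite big_split -!mulr_sumr p2 q2 /=; ring.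
transitivity (x * contracted c l l' m m' (fun i j i' j' => phi (u ++ [:: (i, j); (i', j')] ++ v))
  + y * contracted c l l' m m' (fun i j i' j' => psi (u ++ [:: (i, j); (i', j')] ++ v))).
  rewrite /contracted !mulr_sumr -big_split; apply: eq_bigr => i _ /=.
  rewrite !mulr_sumr -big_split; apply: eq_bigr => i' _ /=.
  rewrite !(mulrCA _ (_ * _)) -mulrDr; congr (_ * _).
  rewrite !mulr_sumr -big_split; apply: eq_bigr => j _ /=.
  rewrite !mulr_sumr -big_split; apply: eq_bigr => j' _ /=.
  by ring.
by rewrite p3 // q3 // !mulr0 addr0.
Qed.

Hypothesis N_gt0 : (0 < N)%N.
Hypotheses (hh : sign_hadamard h) (hk : sign_hadamard k).

(** This is the orthogonality of the basis of colour [c], used at both sites. *)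
Lemma contract_gate g (c : bool) (l l' : 'I_N) (f : seq 'I_N -> F) s : sign_hadamard g ->
  \sum_a \sum_b base g c l a * base g c l' b * gate g c 0 f [:: a, b & s] =
  (l == l')%:R * \sum_a \sum_b base g c l a * base g c l' b * f [:: a, b & s].
Proof.
move=> gg; under eq_bigr do under eq_bigr do rewrite gate0E.
rewrite contract2 (eq_bigr (fun n => (l == n)%:R * (weight F N c ^+ 2 *
  ((l' == n)%:R * project g c n f s)))).
  rewrite sum_delta eq_sym; have w0 := weight_neq0 F N_gt0 c.
  by case: eqP => [<-|_]; rewrite ?mul0r ?mulr0 // !mul1r mulrA mulVf ?mul1r ?expf_neq0.
by move=> n _; rewrite !base_orthogonal //; ring.
Qed.

(** The relations on rows and columns are the compatibility of [p] with cups and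
caps.  For the last clause, contract the compatibility of [p] with a gate by basis
vectors on both sides: the contraction [X] satisfies [(l == l') X = (m == m') X]. *)
Lemma respects_intertwiner p :
  (forall c i s t, size s = size t -> (i.+1 < size s)%N ->
     gate h c i (fun r => p r t) s = gate k c i (p s) t) ->
  (forall i s t, size t = (size s).+2 -> (i <= size s)%N ->
     cap i (fun r => p r t) s = cup i (p s) t) ->
  (forall i s t, size s = (size t).+2 -> (i <= size t)%N ->
     cup i (fun r => p r t) s = cap i (p s) t) ->
  respects_relations (fun w => p (unzip2 w) (unzip1 w)).
Proof.
move=> pg pcap pcup u v.
have suv : size (unzip1 u) = size (unzip2 u) by rewrite !size_map.
split=> [i i'|j j'|c l l' m m' lm].
- transitivity (cap (size (unzip2 u) + 0) (fun r => p r (unzip1 u ++ [:: i, i' & unzip1 v]))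
    (unzip2 u ++ unzip2 v)).
    by rewrite cap_cat; apply: eq_bigr => j _; rewrite /unzip1 /unzip2 !map_cat.
  rewrite pcap; [|by rewrite !size_cat /= !size_map; lia|by rewrite addn0 size_cat leq_addr].
  by rewrite -suv cup_cat /= /unzip1 /unzip2 !map_cat.
- transitivity (cap (size (unzip1 u) + 0) (p (unzip2 u ++ [:: j, j' & unzip2 v]))
    (unzip1 u ++ unzip1 v)).
    by rewrite cap_cat; apply: eq_bigr => i _; rewrite /unzip1 /unzip2 !map_cat.
  rewrite -pcup; [|by rewrite !size_cat /= !size_map; lia|by rewrite addn0 size_cat leq_addr].
  by rewrite suv cup_cat /= /unzip1 /unzip2 !map_cat.
pose q s t := p (unzip2 u ++ s) (unzip1 u ++ t).
have qg i j i' j' : gate h c 0 (fun r => q r [:: i, i' & unzip1 v]) [:: j, j' & unzip2 v] =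
                    gate k c 0 (q [:: j, j' & unzip2 v]) [:: i, i' & unzip1 v].
  rewrite /q; have := gate_cat h c 0 (unzip2 u) (fun r => p r (unzip1 u ++ [:: i, i' & unzip1 v]))
    [:: j, j' & unzip2 v] => <-.
  have := gate_cat k c 0 (unzip1 u) (p (unzip2 u ++ [:: j, j' & unzip2 v])) [:: i, i' & unzip1 v] => <-.
  by rewrite suv pg // !size_cat /= !size_map; lia.
pose X := contracted c l l' m m' (fun i j i' j' => q [:: j, j' & unzip2 v] [:: i, i' & unzip1 v]).
have X1 : (l == l')%:R * X = contracted c l l' m m'
    (fun i j i' j' => gate h c 0 (fun r => q r [:: i, i' & unzip1 v]) [:: j, j' & unzip2 v]).
  rewrite /X /contracted mulr_sumr; apply: eq_bigr => i _.
  rewrite mulr_sumr; apply: eq_bigr => i' _.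
  by rewrite contract_gate // mulrCA.
have X2 : (m == m')%:R * X = contracted c l l' m m'
    (fun i j i' j' => gate k c 0 (q [:: j, j' & unzip2 v]) [:: i, i' & unzip1 v]).
  have swap G : contracted c l l' m m' G = \sum_j \sum_j' base h c l j * base h c l' j' *
      \sum_i \sum_i' base k c m i * base k c m' i' * G i j i' j'.
    rewrite /contracted pair_big [RHS]pair_big /=.
    under eq_bigr do rewrite pair_big mulr_sumr /=.
    under [RHS]eq_bigr do rewrite pair_big mulr_sumr /=.
    by rewrite exchange_big; apply: eq_bigr => y _; apply: eq_bigr => z _; rewrite mulrCA.
  rewrite /X !swap mulr_sumr; apply: eq_bigr => j _.
  rewrite mulr_sumr; apply: eq_bigr => j' _.
  by rewrite contract_gate // mulrCA.
have X0 : X = 0.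
  have : (l == l')%:R * X = (m == m')%:R * X.
    rewrite X1 X2; apply: eq_bigr => i _; apply: eq_bigr => i' _; congr (_ * _).
    by apply: eq_bigr => j _; apply: eq_bigr => j' _; rewrite qg.
  by move: lm; case: (l == l'); case: (m == m') => //= _; rewrite mul0r mul1r.
rewrite -[RHS]X0 /X /contracted.
apply: eq_bigr => i _; apply: eq_bigr => i' _; congr (_ * _).
apply: eq_bigr => j _; apply: eq_bigr => j' _; congr (_ * _).
by rewrite /q /unzip1 /unzip2 !map_cat.
Qed.

(** Averaging over the reversal of words makes the functional hermitian, and is
harmless because the relations are stable under reversal. *)
Theorem exists_functional : exists phi,
  [/\ phi [::] = 1, forall w, phi (rev w) = phi w & respects_relations phi].
Proof.
have [p [p1 pg pcap pcup]] := exists_intertwiner N_gt0 hh hk.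
pose phi w := p (unzip2 w) (unzip1 w).
have rphi : respects_relations phi by apply: respects_intertwiner.
exists (fun w => 2^-1 * phi w + 2^-1 * phi (rev w)); split.
- by rewrite /phi /= p1; field.
- by move=> w; rewrite revK addrC.
by apply: respects_add => //; apply: respects_rev.
Qed.

End Functional.

(** * The star algebra of a functional on words *)

Record word_state (C : numClosedFieldType) (X : choiceType) := WordState {
  state_of :> seq X -> C;
  state_rev : forall w, state_of (rev w) = (state_of w)^*;
  state_nil : state_of [::] = 1
}.

Section Words.
Variables (C : numClosedFieldType) (X : choiceType).

(** Polynomials in noncommuting variables, as unreduced lists of monomials: the
quotient below does not distinguish different lists for the same polynomial. *)
Definition formal_sum : Type := seq (C * seq X).

Definition evaluate (a : formal_sum) (f : seq X -> C) : C := \sum_(m <- a) m.1 * f m.2.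

Lemma eq_evaluate a f g : (forall w, f w = g w) -> evaluate a f = evaluate a g.
Proof. by move=> fg; apply: eq_bigr => m _; rewrite fg. Qed.

Lemma evaluate_cat a b f : evaluate (a ++ b) f = evaluate a f + evaluate b f.
Proof. exact: big_cat. Qed.

Lemma evaluate1 x w f : evaluate [:: (x, w)] f = x * f w.
Proof. exact: big_seq1. Qed.

Lemma evaluateD a f g : evaluate a (fun w => f w + g w) = evaluate a f + evaluate a g.
Proof. by rewrite -big_split; apply: eq_bigr => m _; rewrite mulrDr. Qed.

Lemma evaluateZ a x f : evaluate a (fun w => x * f w) = x * evaluate a f.
Proof. by rewrite /evaluate mulr_sumr; apply: eq_bigr => m _; rewrite mulrCA. Qed.

Lemma evaluate_scale x a f :
  evaluate [seq (x * m.1, m.2) | m <- a] f = x * evaluate a f.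
Proof. by rewrite /evaluate big_map mulr_sumr; apply: eq_bigr => m _; rewrite mulrA. Qed.

Lemma evaluateC a b (f : seq X -> seq X -> C) :
  evaluate a (fun w => evaluate b (f w)) = evaluate b (fun w' => evaluate a (f^~ w')).
Proof.
rewrite /evaluate; under eq_bigr do rewrite mulr_sumr.
rewrite exchange_big; apply: eq_bigr => m _; rewrite mulr_sumr.
by apply: eq_bigr => n _; rewrite mulrCA.
Qed.

Lemma evaluate_mul a b f :
  evaluate [seq (m.1 * n.1, m.2 ++ n.2) | m <- a, n <- b] f =
  evaluate a (fun w => evaluate b (fun w' => f (w ++ w'))).
Proof.
rewrite /evaluate big_allpairs_dep; apply: eq_bigr => m _; rewrite mulr_sumr.
by apply: eq_bigr => n _; rewrite mulrA.
Qed.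

Lemma evaluate_conj a f :
  evaluate [seq (m.1^*, rev m.2) | m <- a] f = (evaluate a (fun w => (f (rev w))^*))^*.
Proof.
rewrite /evaluate big_map rmorph_sum; apply: eq_bigr => m _.
by rewrite rmorphM /= conjCK.
Qed.

Variable phi : word_state C X.

(** Congruence modulo the largest two-sided ideal on which [phi] vanishes. *)
Definition equivalent : rel formal_sum := fun a b =>
  `[< forall u v, evaluate a (fun w => phi (u ++ w ++ v)) =
                  evaluate b (fun w => phi (u ++ w ++ v)) >].

Lemma equivalent_is_equiv : equiv_class_of equivalent.
Proof.
split=> [a|a b|b a c]; first by apply/asboolP.
  by apply/asboolP/asboolP => ab u v; rewrite ab.
by move=> /asboolP ab /asboolP bc; apply/asboolP => u v; rewrite ab.
Qed.

Canonical equivalent_equiv := EquivRelPack equivalent_is_equiv.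

Definition word_algebra := {eq_quot equivalent}.
HB.instance Definition _ := Choice.on word_algebra.
HB.instance Definition _ := EqQuotient.on word_algebra.

Implicit Types x y z : word_algebra.

Definition class_of (a : formal_sum) : word_algebra := \pi_word_algebra a.

(** The numbers [phi (u x v)] determine [x] ([coefficient_inj]), so every identity
in the quotient is checked on them. *)
Definition coefficient x (u v : seq X) : C :=
  evaluate (repr x) (fun w => phi (u ++ w ++ v)).

Lemma coefficient_class a u v :
  coefficient (class_of a) u v = evaluate a (fun w => phi (u ++ w ++ v)).
Proof.
have : repr (class_of a) = a %[mod word_algebra] by rewrite reprK.
by move/eqmodP/asboolP => e; exact: e.
Qed.

Lemma coefficient_inj x y :
  (forall u v, coefficient x u v = coefficient y u v) -> x = y.
Proof.
move=> xy; rewrite -[x]reprK -[y]reprK; apply/eqmodP; apply/asboolP=> u v.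
exact: xy.
Qed.

Definition word_add x y := class_of (repr x ++ repr y).
Definition word_zero := class_of [::].
Definition word_scale (c : C) x := class_of [seq (c * m.1, m.2) | m <- repr x].
Definition word_opp x := word_scale (-1) x.
Definition word_mul x y :=
  class_of [seq (m.1 * n.1, m.2 ++ n.2) | m <- repr x, n <- repr y].
Definition word_one := class_of [:: (1, [::])].
Definition word_star x := class_of [seq (m.1^*, rev m.2) | m <- repr x].

Lemma coefficientD x y u v :
  coefficient (word_add x y) u v = coefficient x u v + coefficient y u v.
Proof. by rewrite coefficient_class evaluate_cat. Qed.

Lemma coefficient0 u v : coefficient word_zero u v = 0.
Proof. by rewrite coefficient_class /evaluate big_nil. Qed.

Lemma coefficientZ c x u v : coefficient (word_scale c x) u v = c * coefficient x u v.
Proof. by rewrite coefficient_class evaluate_scale. Qed.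

Lemma coefficientN x u v : coefficient (word_opp x) u v = - coefficient x u v.
Proof. by rewrite coefficientZ mulN1r. Qed.

Lemma coefficient1 u v : coefficient word_one u v = phi (u ++ v).
Proof. by rewrite coefficient_class evaluate1 mul1r. Qed.

Lemma coefficient_star x u v :
  coefficient (word_star x) u v = (coefficient x (rev v) (rev u))^*.
Proof.
rewrite coefficient_class evaluate_conj; congr (_^*); apply: eq_evaluate => w.
by rewrite -state_rev !rev_cat revK catA.
Qed.

(** Choosing the representative of either factor gives two formulas for a product;
associativity and distributivity follow by combining them. *)
Lemma coefficientMr x y u v :
  coefficient (word_mul x y) u v = evaluate (repr x) (fun w => coefficient y (u ++ w) v).
Proof.
rewrite coefficient_class evaluate_mul; apply: eq_evaluate => w.
by apply: eq_evaluate => w'; rewrite -!catA.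
Qed.

Lemma coefficientMl x y u v :
  coefficient (word_mul x y) u v = evaluate (repr y) (fun w => coefficient x u (w ++ v)).
Proof.
rewrite coefficientMr evaluateC; apply: eq_evaluate => w.
by apply: eq_evaluate => w'; rewrite -!catA.
Qed.

Lemma coefficientM_class a b u v :
  coefficient (word_mul (class_of a) (class_of b)) u v =
  evaluate a (fun w => evaluate b (fun w' => phi (u ++ w ++ w' ++ v))).
Proof.
rewrite coefficientMl; under eq_evaluate do rewrite coefficient_class.
rewrite evaluateC; apply: eq_evaluate => w.
have := coefficient_class b (u ++ w) v; rewrite /coefficient.
under eq_evaluate do rewrite -catA; move=> ->.
by apply: eq_evaluate => w'; rewrite -catA.
Qed.

Fact word_addA : associative word_add.
Proof. by move=> x y z; apply: coefficient_inj => u v; rewrite !coefficientD addrA. Qed.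

Fact word_addC : commutative word_add.
Proof. by move=> x y; apply: coefficient_inj => u v; rewrite !coefficientD addrC. Qed.

Fact word_add0 : left_id word_zero word_add.
Proof. by move=> x; apply: coefficient_inj => u v; rewrite coefficientD coefficient0 add0r. Qed.

Fact word_addN : left_inverse word_zero word_opp word_add.
Proof.
move=> x; apply: coefficient_inj => u v.
by rewrite coefficientD coefficientN coefficient0 addNr.
Qed.

HB.instance Definition _ :=
  GRing.isZmodule.Build word_algebra word_addA word_addC word_add0 word_addN.

Fact word_mulA : associative word_mul.
Proof.
move=> x y z; apply: coefficient_inj => u v.
rewrite coefficientMr [RHS]coefficientMl.
under eq_evaluate do rewrite coefficientMl.
by under [RHS]eq_evaluate do rewrite coefficientMr; rewrite evaluateC.
Qed.

Fact word_mul1 : left_id word_one word_mul.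
Proof.
move=> x; apply: coefficient_inj => u v; rewrite coefficientMl.
by under eq_evaluate do rewrite coefficient1.
Qed.

Fact word_mulr1 : right_id word_one word_mul.
Proof.
move=> x; apply: coefficient_inj => u v; rewrite coefficientMr.
by under eq_evaluate do rewrite coefficient1 -catA.
Qed.

Fact word_mulDl : left_distributive word_mul word_add.
Proof.
move=> x y z; apply: coefficient_inj => u v; rewrite coefficientD !coefficientMl.
by rewrite -evaluateD; apply: eq_evaluate => w; rewrite coefficientD.
Qed.

Fact word_mulDr : right_distributive word_mul word_add.
Proof.
move=> x y z; apply: coefficient_inj => u v; rewrite coefficientD !coefficientMr.
by rewrite -evaluateD; apply: eq_evaluate => w; rewrite coefficientD.
Qed.

Fact word_oner_neq0 : word_one != 0 :> word_algebra.
Proof.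
apply/eqP => e; have := coefficient1 [::] [::]; rewrite e coefficient0 state_nil.
by move/eqP; rewrite eq_sym oner_eq0.
Qed.

HB.instance Definition _ := GRing.Zmodule_isNzRing.Build word_algebra
  word_mulA word_mul1 word_mulr1 word_mulDl word_mulDr word_oner_neq0.

Fact word_scaleA c d x : word_scale c (word_scale d x) = word_scale (c * d) x.
Proof. by apply: coefficient_inj => u v; rewrite !coefficientZ mulrA. Qed.

Fact word_scale1 : left_id 1 word_scale.
Proof. by move=> x; apply: coefficient_inj => u v; rewrite coefficientZ mul1r. Qed.

Fact word_scaleDr : right_distributive word_scale +%R.
Proof.
by move=> c x y; apply: coefficient_inj => u v; rewrite !(coefficientZ, coefficientD) mulrDr.
Qed.

Fact word_scaleDl x : {morph word_scale^~ x : c d / c + d}.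
Proof.
by move=> c d; apply: coefficient_inj => u v; rewrite !(coefficientZ, coefficientD) mulrDl.
Qed.

HB.instance Definition _ := GRing.Zmodule_isLmodule.Build C word_algebra
  word_scaleA word_scale1 word_scaleDr word_scaleDl.

Fact word_scaleAl (c : C) x y : c *: (x * y) = c *: x * y.
Proof.
apply: coefficient_inj => u v; rewrite coefficientZ !coefficientMl -evaluateZ.
by apply: eq_evaluate => w; rewrite coefficientZ.
Qed.

HB.instance Definition _ := GRing.Lmodule_isLalgebra.Build C word_algebra word_scaleAl.

Fact word_scaleAr (c : C) x y : c *: (x * y) = x * (c *: y).
Proof.
apply: coefficient_inj => u v; rewrite coefficientZ !coefficientMr -evaluateZ.
by apply: eq_evaluate => w; rewrite coefficientZ.
Qed.

HB.instance Definition _ := GRing.Lalgebra_isAlgebra.Build C word_algebra word_scaleAr.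

Fact word_starK : involutive word_star.
Proof.
by move=> x; apply: coefficient_inj => u v; rewrite !coefficient_star !revK conjCK.
Qed.

Fact word_starD : {morph word_star : x y / x + y}.
Proof.
move=> x y; apply: coefficient_inj => u v.
by rewrite !(coefficient_star, coefficientD) rmorphD.
Qed.

Fact word_starM x y : word_star (x * y) = word_star y * word_star x.
Proof.
apply: coefficient_inj => u v; rewrite coefficient_star coefficientM_class.
rewrite evaluate_conj coefficientMl; congr (_^*).
apply: eq_evaluate => w; rewrite evaluate_conj conjCK.
apply: eq_evaluate => w'; rewrite -state_rev; congr (phi _).
by rewrite !rev_cat !revK !catA.
Qed.

Fact word_starZ (c : C) x : word_star (c *: x) = c^* *: word_star x.
Proof.
apply: coefficient_inj => u v.
by rewrite coefficient_star !coefficientZ coefficient_star rmorphM.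
Qed.

HB.instance Definition _ := Algebra_hasStar.Build C word_algebra
  word_starK word_starD word_starM word_starZ.

Definition generator (a : X) : word_algebra := class_of [:: (1, [:: a])].

Lemma star_generator a : star (generator a) = generator a.
Proof.
apply: coefficient_inj => u v; rewrite coefficient_star !coefficient_class !evaluate1 !mul1r.
by rewrite -state_rev !rev_cat !revK catA.
Qed.

Lemma coefficient_generators a b u v :
  coefficient (generator a * generator b) u v = phi (u ++ [:: a; b] ++ v).
Proof. by rewrite coefficientM_class !evaluate1 !mul1r. Qed.

Lemma coefficient_one u v : coefficient 1 u v = phi (u ++ v).
Proof. exact: coefficient1. Qed.

Lemma coefficient_scale (c : C) x u v : coefficient (c *: x) u v = c * coefficient x u v.
Proof. exact: coefficientZ. Qed.

Lemma coefficient_zero u v : coefficient 0 u v = 0.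
Proof. exact: coefficient0. Qed.

Lemma coefficient_sum (I : Type) (r : seq I) (P : pred I) (f : I -> word_algebra) u v :
  coefficient (\sum_(i <- r | P i) f i) u v = \sum_(i <- r | P i) coefficient (f i) u v.
Proof.
apply: (big_morph (fun x => coefficient x u v)) => [x y|]; first exact: coefficientD.
exact: coefficient0.
Qed.

End Words.

(** * Signed magic matrices *)

Section StarAlgebra.
Variables (C : numClosedFieldType) (A : starAlgType C).

Lemma star0 : star (0 : A) = 0.
Proof. by apply: (addIr (star (0 : A))); rewrite -starD !add0r. Qed.

Lemma star_sum (I : Type) (r : seq I) (P : pred I) (f : I -> A) :
  star (\sum_(i <- r | P i) f i) = \sum_(i <- r | P i) star (f i).
Proof. exact: (big_morph _ (@starD _ A) star0). Qed.

Lemma star1 : star (1 : A) = 1.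
Proof. by rewrite -[LHS]mulr1 -[X in _ * X](@starK _ A) -starM mulr1 starK. Qed.

Lemma starN (a : A) : star (- a) = - star a.
Proof. by apply: (addIr (star a)); rewrite -starD !addNr star0. Qed.

Lemma star_alg (c : C) : star (c%:A : A) = c^*%:A.
Proof. by rewrite starZ star1. Qed.

Lemma adjointmx_mul m n p (a : 'M[A]_(m, n)) (b : 'M[A]_(n, p)) :
  adjointmx (a *m b) = adjointmx b *m adjointmx a.
Proof.
apply/matrixP=> i j; rewrite !mxE star_sum; apply: eq_bigr => k _.
by rewrite starM !mxE.
Qed.

Lemma adjointmx_block m1 m2 n1 n2 (a : 'M[A]_(m1, n1)) (b : 'M[A]_(m1, n2))
    (c : 'M[A]_(m2, n1)) (d : 'M[A]_(m2, n2)) :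
  adjointmx (block_mx a b c d) =
  block_mx (adjointmx a) (adjointmx c) (adjointmx b) (adjointmx d).
Proof.
apply/matrixP=> i j; rewrite mxE.
by case: (split_ordP i) => i' ->; case: (split_ordP j) => j' ->;
  rewrite ?(block_mxEul, block_mxEur, block_mxEdl, block_mxEdr) !mxE.
Qed.

Lemma adjointmx0 m n : adjointmx (0 : 'M[A]_(m, n)) = 0.
Proof. by apply/matrixP=> i j; rewrite !mxE star0. Qed.

(** Complex scalars are central even though the entries of [x] do not commute. *)
Lemma map_scalar_mxC (c : C) m n (x : 'M[A]_(m, n)) :
  map_mx (in_alg A) c%:M *m x = x *m map_mx (in_alg A) c%:M.
Proof.
rewrite map_scalar_mx mul_scalar_mx; apply/matrixP=> i j; rewrite !mxE.
rewrite (bigD1 j) //= big1 => [|k kj]; last by rewrite !mxE (negPf kj) mulr0n /= scale0r mulr0.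
by rewrite !mxE eqxx addr0 mulr1n /= mulr_algl mulr_algr.
Qed.

(** The square of a signed magic matrix, taken entry by entry, is a magic unitary,
and its entries are self-adjoint partial isometries: quantum signed
permutations. *)
Definition signed_magic n (x : 'M[A]_n) : Prop :=
  [/\ forall i j, star (x i j) = x i j,
      forall i j j', j != j' -> x i j * x i j' = 0,
      forall i i' j, i != i' -> x i j * x i' j = 0,
      forall i, \sum_j x i j * x i j = 1
    & forall j, \sum_i x i j * x i j = 1].

Lemma signed_magic_tr n (x : 'M[A]_n) : signed_magic x -> signed_magic x^T.
Proof.
case=> s r c sr sc; split=> [i j|i j j' jj|i i' j ii|i|j]; rewrite ?mxE.
- exact: s.
- exact: c.
- exact: r.
- by under eq_bigr do rewrite !mxE; exact: sc.
by under eq_bigr do rewrite !mxE; exact: sr.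
Qed.

Lemma signed_magic_cube n (x : 'M[A]_n) i j : signed_magic x ->
  x i j * (x i j * x i j) = x i j.
Proof.
case=> _ r _ sr _; have := congr1 (fun a => x i j * a) (sr i).
rewrite mulr1 (bigD1 j) //= mulrDr mulr_sumr big1 ?addr0 // => j' jj.
by rewrite mulrA r ?mul0r // eq_sym.
Qed.

(** For a self-adjoint [a] with [a^3 = a] these are the spectral projections for the
eigenvalues [1] and [-1]. *)
Definition positive_part (a : A) := 2^-1 *: (a * a + a).
Definition negative_part (a : A) := 2^-1 *: (a * a - a).

Lemma parts_sum a : positive_part a + negative_part a = a * a.
Proof.
rewrite -scalerDr addrACA subrr addr0 -mulr2n -scaler_nat scalerA mulVf ?scale1r //.
by rewrite pnatr_eq0.
Qed.

Lemma halfK (a : A) : 2^-1 *: (a *+ 2) = a.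
Proof. by rewrite -scaler_nat scalerA mulVf ?scale1r // pnatr_eq0. Qed.

Lemma parts_product a b :
  positive_part a * positive_part b + negative_part a * negative_part b =
  2^-1 *: (a * a * (b * b) + a * b).
Proof.
rewrite -!scalerAl -!scalerAr !scalerA -scalerDr -[in RHS](halfK (_ + _)) scalerA.
congr (_ *: _); rewrite !mulrDl !mulrDr !mulrN !mulNr opprK.
set w1 := a * a * _; set w2 := a * a * b; set w3 := a * (b * b); set w4 := a * b.
rewrite addrACA [w1 + w2 + _]addrACA [w3 + w4 + _]addrACA !subrr addr0 add0r.
by rewrite -mulr2n -[w4 + w4]mulr2n -mulrnDl.
Qed.

Lemma positive_partN a : positive_part (- a) = negative_part a.
Proof. by rewrite /positive_part mulrNN. Qed.

Lemma negative_partN a : negative_part (- a) = positive_part a.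
Proof. by rewrite /negative_part mulrNN opprK. Qed.

Lemma parts_cross a b :
  positive_part a * negative_part b + negative_part a * positive_part b =
  2^-1 *: (a * a * (b * b) - a * b).
Proof. by rewrite -(positive_partN b) -(negative_partN b) parts_product mulrNN mulrN. Qed.

Lemma parts_scalar (c : C) a :
  (2^-1 * (1 + c)) *: positive_part a + (2^-1 * (1 - c)) *: negative_part a =
  2^-1 *: (a * a + c *: a).
Proof.
rewrite /positive_part /negative_part -!scalerA -scalerDr; congr (_ *: _).
rewrite !scalerA !scalerDr scalerN addrACA -scalerDl -scaleNr -scalerDl.
have two : (2 : C) != 0 by rewrite pnatr_eq0.
have -> : (1 + c) / 2 + (1 - c) / 2 = 1 by field.
have -> : (1 + c) / 2 - (1 - c) / 2 = c by field.
by rewrite scale1r.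
Qed.

Lemma parts_scalarN (c : C) a :
  (2^-1 * (1 + c)) *: negative_part a + (2^-1 * (1 - c)) *: positive_part a =
  2^-1 *: (a * a - c *: a).
Proof. by rewrite -(positive_partN a) -(negative_partN a) parts_scalar mulrNN scalerN. Qed.

(** A signed permutation of [n] points as a permutation of [2n] points. *)
Definition split_mx n (x : 'M[A]_n) : 'M[A]_(n + n) :=
  block_mx (map_mx positive_part x) (map_mx negative_part x)
           (map_mx negative_part x) (map_mx positive_part x).

Lemma adjointmx_split n (x : 'M[A]_n) : signed_magic x ->
  adjointmx (split_mx x) = split_mx x^T.
Proof.
case=> s _ _ _ _; rewrite adjointmx_block /split_mx.
have h2 : (2^-1 : C)^* = 2^-1 by rewrite fmorphV rmorph_nat.
by congr block_mx; apply/matrixP=> i j;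
  rewrite !mxE starZ starD ?starN starM s h2.
Qed.

Lemma split_mx_tr n (x : 'M[A]_n) : signed_magic x ->
  split_mx x *m split_mx x^T = 1%:M.
Proof.
move=> mx; have [s r c sr sc] := mx.
have cube i j : x i j * x i j * (x i j * x i j) = x i j * x i j.
  by rewrite -mulrA signed_magic_cube.
rewrite mulmx_block (scalar_mx_block n n 1).
have E1 : map_mx positive_part x *m map_mx positive_part x^T +
          map_mx negative_part x *m map_mx negative_part x^T = 1%:M.
  apply/matrixP=> i i'; rewrite !mxE -big_split /=.
  under eq_bigr do rewrite !mxE parts_product.
  have [<-|ii] := eqVneq i i'.
    by under eq_bigr do rewrite cube -mulr2n halfK; rewrite sr.
  rewrite mulr0n big1 // => j _.
  by rewrite mulrA -[x i j * x i j * _]mulrA c // !mulr0 mul0r addr0 scaler0.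
have E0 : map_mx positive_part x *m map_mx negative_part x^T +
          map_mx negative_part x *m map_mx positive_part x^T = 0.
  apply/matrixP=> i i'; rewrite !mxE -big_split /=.
  rewrite big1 // => j _; rewrite !mxE parts_cross.
  have [<-|ii] := eqVneq i i'; first by rewrite cube subrr scaler0.
  by rewrite mulrA -[x i j * x i j * _]mulrA c // !mulr0 mul0r subr0 scaler0.
by rewrite E1 E0 ![map_mx negative_part x *m _ + _]addrC E1 E0.
Qed.

Lemma positive_part_proj (a : A) : a * (a * a) = a ->
  positive_part a ^+ 2 = positive_part a.
Proof.
move=> cube; rewrite expr2 -scalerAl -scalerAr; congr (_ *: _).
rewrite -[RHS]halfK; congr (_ *: _).
by rewrite mulrDl !mulrDr -!mulrA !cube [a + _]addrC mulr2n.
Qed.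

Lemma negative_part_proj (a : A) : a * (a * a) = a ->
  negative_part a ^+ 2 = negative_part a.
Proof.
by move=> cube; rewrite -positive_partN positive_part_proj // mulrNN mulNr cube.
Qed.

Lemma sum_split_row n (x : 'M[A]_n) : (forall i, \sum_j x i j * x i j = 1) ->
  forall i, \sum_j split_mx x i j = 1.
Proof.
move=> sr i; rewrite big_split_ord /=; case: (split_ordP i) => i' ->.
  under eq_bigr do rewrite block_mxEul mxE.
  under [X in _ + X]eq_bigr do rewrite block_mxEur mxE.
  by rewrite -big_split /= -[RHS](sr i'); apply: eq_bigr => j _; rewrite parts_sum.
under eq_bigr do rewrite block_mxEdl mxE.
under [X in _ + X]eq_bigr do rewrite block_mxEdr mxE.
by rewrite -big_split /= -[RHS](sr i'); apply: eq_bigr => j _; rewrite addrC parts_sum.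
Qed.

Lemma tr_split_mx n (x : 'M[A]_n) : (split_mx x)^T = split_mx x^T.
Proof. by rewrite tr_block_mx !map_trmx. Qed.

Lemma magic_split n (x : 'M[A]_n) : signed_magic x -> magic_unitary (split_mx x).
Proof.
move=> mx; have [s r c sr sc] := mx; have mxt := signed_magic_tr mx.
have cube i j := signed_magic_cube i j mx.
have h2 : (2^-1 : C)^* = 2^-1 by rewrite fmorphV rmorph_nat.
have starP i j : star (positive_part (x i j)) = positive_part (x i j).
  by rewrite starZ starD starM s h2.
have starQ i j : star (negative_part (x i j)) = negative_part (x i j).
  by rewrite starZ starD starN starM s h2.
split.
- by rewrite adjointmx_split // split_mx_tr.
- by rewrite adjointmx_split // -{2}[x]trmxK split_mx_tr.
- move=> i j; case: (split_ordP i) => i' ->; case: (split_ordP j) => j' ->;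
    rewrite ?(block_mxEul, block_mxEur, block_mxEdl, block_mxEdr) !mxE;
    by rewrite ?starP ?starQ ?positive_part_proj ?negative_part_proj.
- exact: sum_split_row.
move=> j; have [_ _ _ sr' _] := mxt.
rewrite -[RHS](sum_split_row sr' j) -tr_split_mx.
by apply: eq_bigr => i _; rewrite [RHS]mxE.
Qed.

Lemma magic_block m1 n1 m2 n2 (v : 'M[A]_(m1, n1)) (w : 'M[A]_(m2, n2)) :
  magic_unitary v -> magic_unitary w -> magic_unitary (block_mx v 0 0 w).
Proof.
case=> v1 v2 v3 v4 v5 [w1 w2 w3 w4 w5]; split.
- rewrite adjointmx_block !adjointmx0 mulmx_block v1 w1 !mulmx0 !mul0mx.
  by rewrite !addr0 add0r -scalar_mx_block.
- rewrite adjointmx_block !adjointmx0 mulmx_block v2 w2 !mulmx0 !mul0mx.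
  by rewrite !addr0 add0r -scalar_mx_block.
- move=> i j; case: (split_ordP i) => i' ->; case: (split_ordP j) => j' ->;
    rewrite ?(block_mxEul, block_mxEur, block_mxEdl, block_mxEdr) ?mxE //;
    by rewrite expr0n /= star0.
- move=> i; rewrite big_split_ord /=; case: (split_ordP i) => i' ->.
    under eq_bigr do rewrite block_mxEul.
    by under [X in _ + X]eq_bigr do rewrite block_mxEur mxE; rewrite v4 big1 ?addr0.
  under eq_bigr do rewrite block_mxEdl mxE.
  by under [X in _ + X]eq_bigr do rewrite block_mxEdr; rewrite w4 big1 ?add0r.
move=> j; rewrite big_split_ord /=; case: (split_ordP j) => j' ->.
  under eq_bigr do rewrite block_mxEul.
  by under [X in _ + X]eq_bigr do rewrite block_mxEdl mxE; rewrite v5 big1 ?addr0.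
under eq_bigr do rewrite block_mxEur mxE.
by under [X in _ + X]eq_bigr do rewrite block_mxEdr; rewrite w5 big1 ?add0r.
Qed.

(** The nonzero block of the adjacency matrix of a Hadamard graph; [half_shift] is
the same construction for entries in [A]. *)
Definition double (n : nat) (H : 'M[C]_n) : 'M[C]_(n + n) :=
  block_mx (hplus H) (hminus H) (hminus H) (hplus H).

Definition half_shift n (g : 'M[A]_n) : 'M[A]_(n + n) :=
  block_mx (map_mx (fun a => 2^-1 *: (1 + a)) g) (map_mx (fun a => 2^-1 *: (1 - a)) g)
           (map_mx (fun a => 2^-1 *: (1 - a)) g) (map_mx (fun a => 2^-1 *: (1 + a)) g).

(** The all-ones part of [double H] meets only the squares of the entries of [x],
whose rows sum to [1], so the product sees [x] through [x H] alone. *)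
Lemma split_mul_double n (x : 'M[A]_n) (H : 'M[C]_n) : signed_magic x ->
  split_mx x *m map_mx (in_alg A) (double H) = half_shift (x *m map_mx (in_alg A) H).
Proof.
case=> _ _ _ sr _; rewrite map_block_mx mulmx_block.
have E1 : map_mx positive_part x *m map_mx (in_alg A) (hplus H) +
    map_mx negative_part x *m map_mx (in_alg A) (hminus H) =
    map_mx (fun a => 2^-1 *: (1 + a)) (x *m map_mx (in_alg A) H).
  apply/matrixP=> i j; rewrite !mxE -(sr i) -!big_split scaler_sumr.
  by apply: eq_bigr => k _ /=; rewrite !mxE !mulr_algr parts_scalar.
have E2 : map_mx positive_part x *m map_mx (in_alg A) (hminus H) +
    map_mx negative_part x *m map_mx (in_alg A) (hplus H) =
    map_mx (fun a => 2^-1 *: (1 - a)) (x *m map_mx (in_alg A) H).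
  apply/matrixP=> i j; rewrite !mxE -(sr i) -sumrB -big_split scaler_sumr.
  by apply: eq_bigr => k _ /=; rewrite !mxE !mulr_algr addrC parts_scalarN.
by rewrite E1 E2 ![map_mx negative_part x *m _ + _]addrC E1 E2.
Qed.

Lemma double_mul_split n (y : 'M[A]_n) (K : 'M[C]_n) : signed_magic y ->
  map_mx (in_alg A) (double K) *m split_mx y = half_shift (map_mx (in_alg A) K *m y).
Proof.
case=> _ _ _ _ sc; rewrite map_block_mx mulmx_block.
have E1 : map_mx (in_alg A) (hplus K) *m map_mx positive_part y +
    map_mx (in_alg A) (hminus K) *m map_mx negative_part y =
    map_mx (fun a => 2^-1 *: (1 + a)) (map_mx (in_alg A) K *m y).
  apply/matrixP=> i j; rewrite !mxE -(sc j) -!big_split scaler_sumr.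
  by apply: eq_bigr => k _ /=; rewrite !mxE !mulr_algl parts_scalar.
have E2 : map_mx (in_alg A) (hplus K) *m map_mx negative_part y +
    map_mx (in_alg A) (hminus K) *m map_mx positive_part y =
    map_mx (fun a => 2^-1 *: (1 - a)) (map_mx (in_alg A) K *m y).
  apply/matrixP=> i j; rewrite !mxE -(sc j) -sumrB -big_split scaler_sumr.
  by apply: eq_bigr => k _ /=; rewrite !mxE !mulr_algl parts_scalarN.
by rewrite E1 E2 ![map_mx _ (hminus K) *m _ + _]addrC E1 E2.
Qed.

Lemma double_tr n (H : 'M[C]_n) : (double H)^T = double H^T.
Proof.
by rewrite tr_block_mx; congr block_mx; apply/matrixP=> i j; rewrite !mxE.
Qed.

End StarAlgebra.

(** * Hadamard graphs *)

Section Graphs.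
Variable C : numClosedFieldType.

(** The two matrix equations match the off-diagonal blocks of the graphs; the
diagonal blocks are scalar, which covers the looped case with [c = 1] and the other
one with [c = 0]. *)
Lemma quantum_isomorphic_block (A : starAlgType C) n (H K : 'M[C]_n) (x y : 'M[A]_n) (c : C) :
  signed_magic x -> signed_magic y ->
  x *m map_mx (in_alg A) H = map_mx (in_alg A) K *m y ->
  y *m map_mx (in_alg A) H^T = map_mx (in_alg A) K^T *m x ->
  quantum_isomorphic (block_mx c%:M (double H) (double H)^T 0)
                     (block_mx c%:M (double K) (double K)^T 0).
Proof.
move=> mx my xy yx; exists A, (block_mx (split_mx x) 0 0 (split_mx y)).
split; first by apply: magic_block; apply: magic_split.
rewrite !(map_block_mx _ c%:M) [LHS]mulmx_block [RHS]mulmx_block.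
rewrite !map_mx0 !mul0mx !mulmx0 !addr0 !add0r !double_tr.
by rewrite !split_mul_double // !double_mul_split // xy yx map_scalar_mxC.
Qed.

Lemma hadamard_graphE n (H : 'M[C]_n) :
  hadamard_graph H = block_mx 0%:M (double H) (double H)^T 0.
Proof. by rewrite /hadamard_graph !block_mx0 raddf0 tr_block_mx. Qed.

Lemma looped_hadamard_graphE n (H : 'M[C]_n) :
  looped_hadamard_graph H = block_mx 1%:M (double H) (double H)^T 0.
Proof. by rewrite /looped_hadamard_graph block_mx0 tr_block_mx -scalar_mx_block. Qed.

Lemma magic_unitary_size (A : starAlgType C) m n (u : 'M[A]_(m, n)) :
  magic_unitary u -> m = n.
Proof.
case=> _ _ _ rows cols; have : (m%:R : A) = n%:R.
  transitivity (\sum_i \sum_j u i j).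
    by under eq_bigr do rewrite rows; rewrite sumr_const card_ord.
  by rewrite exchange_big; under eq_bigr do rewrite cols; rewrite sumr_const card_ord.
rewrite -!(scaler_nat _ (1 : A)) => /eqP; rewrite -subr_eq0 -scalerBl scaler_eq0.
by rewrite oner_eq0 orbF subr_eq0 eqr_nat => /eqP.
Qed.

Section Quotient.
Variables (N : nat) (H K : 'M[C]_N).
Hypotheses (hH : hadamard H) (hK : hadamard K) (N_gt0 : (0 < N)%N).
Variable phi : word_state C ('I_N * 'I_N)%type.

Local Notation G := (@generator C _ phi).
Local Notation A := (word_algebra phi).

Definition generic_mx : 'M[A]_N := \matrix_(i, j) G (i, j).

(** This is [K^-1 x H] for the matrix [x] of generators. *)
Definition transported_mx : 'M[A]_N :=
  map_mx (in_alg A) (N%:R^-1 *: K^T) *m generic_mx *m map_mx (in_alg A) H.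

Lemma hadamard_conj n (L : 'M[C]_n) : hadamard L -> forall i j, (L i j)^* = L i j.
Proof.
by case=> e _ _ i j; case: (e i j) => ->; rewrite ?rmorphN rmorph1.
Qed.

Let N0 : (N%:R : C) != 0.
Proof. by rewrite pnatr_eq0 -lt0n. Qed.

Lemma generic_mulmx : generic_mx *m map_mx (in_alg A) H = map_mx (in_alg A) K *m transported_mx.
Proof.
rewrite !mulmxA -map_mxM -scalemxAr; case: hK => _ -> _.
by rewrite scale_scalar_mx mulVf // map_mx1 mul1mx.
Qed.

Lemma transported_mulmx :
  transported_mx *m map_mx (in_alg A) H^T = map_mx (in_alg A) K^T *m generic_mx.
Proof.
rewrite -!mulmxA -map_mxM; case: hH => _ -> _.
rewrite -map_scalar_mxC mulmxA -map_mxM mul_mx_scalar scalerA mulfV //.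
by rewrite scale1r.
Qed.

Hypothesis rows : forall u v i i',
  \sum_j phi (u ++ [:: (i, j); (i', j)] ++ v) = (i == i')%:R * phi (u ++ v).
Hypothesis cols : forall u v j j',
  \sum_i phi (u ++ [:: (i, j); (i, j')] ++ v) = (j == j')%:R * phi (u ++ v).
Hypothesis white : forall u v i j i' j', (j == j') != (i == i') ->
  phi (u ++ [:: (i, j); (i', j')] ++ v) = 0.
Hypothesis black : forall u v l l' m m', (l == l') != (m == m') ->
  \sum_i \sum_i' K i m * K i' m' * \sum_j \sum_j' H j l * H j' l' *
    phi (u ++ [:: (i, j); (i', j')] ++ v) = 0.

Lemma signed_magic_generic : signed_magic generic_mx.
Proof.
split=> [i j|i j j' jj|i i' j ii|i|j].
- by rewrite mxE star_generator.
- apply: coefficient_inj => u v; rewrite !mxE coefficient_generators coefficient_zero.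
  by apply: white; rewrite eqxx (negPf jj).
- apply: coefficient_inj => u v; rewrite !mxE coefficient_generators coefficient_zero.
  by apply: white; rewrite eqxx (negPf ii).
- apply: coefficient_inj => u v; rewrite coefficient_sum coefficient_one.
  by under eq_bigr do rewrite mxE coefficient_generators; rewrite rows eqxx mul1r.
apply: coefficient_inj => u v; rewrite coefficient_sum coefficient_one.
by under eq_bigr do rewrite mxE coefficient_generators; rewrite cols eqxx mul1r.
Qed.

Lemma generic_unitary :
  generic_mx *m adjointmx generic_mx = 1%:M /\ adjointmx generic_mx *m generic_mx = 1%:M.
Proof.
split; apply/matrixP=> i j; apply: coefficient_inj => u v.
  rewrite !mxE coefficient_sum.
  under eq_bigr do rewrite !mxE star_generator coefficient_generators.
  rewrite rows; case: eqP => _; first by rewrite mul1r coefficient_one.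
  by rewrite mul0r coefficient_zero.
rewrite !mxE coefficient_sum.
under eq_bigr do rewrite !mxE star_generator coefficient_generators.
rewrite cols; case: eqP => _; first by rewrite mul1r coefficient_one.
by rewrite mul0r coefficient_zero.
Qed.

Lemma transportedE m l : transported_mx m l =
  \sum_i \sum_j (N%:R^-1 * (K i m * H j l)) *: G (i, j).
Proof.
rewrite !mxE exchange_big; apply: eq_bigr => j _; rewrite !mxE mulr_suml.
by apply: eq_bigr => i _; rewrite !mxE /= mulr_algl mulr_algr scalerA; congr (_ *: _); ring.
Qed.

Lemma star_transported m l : star (transported_mx m l) = transported_mx m l.
Proof.
rewrite transportedE star_sum; apply: eq_bigr => i _; rewrite star_sum.
apply: eq_bigr => j _; rewrite starZ star_generator !rmorphM fmorphV rmorph_nat.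
by rewrite /= (hadamard_conj hH) (hadamard_conj hK).
Qed.

Lemma coefficient_transported m l m' l' u v :
  coefficient (transported_mx m l * transported_mx m' l') u v =
  N%:R^-1 ^+ 2 * \sum_i \sum_i' K i m * K i' m' * \sum_j \sum_j' H j l * H j' l' *
    phi (u ++ [:: (i, j); (i', j')] ++ v).
Proof.
rewrite !transportedE [in LHS]mulr_suml coefficient_sum [RHS]mulr_sumr; apply: eq_bigr => i _.
rewrite [in LHS]mulr_sumr coefficient_sum [RHS]mulr_sumr; apply: eq_bigr => i' _.
rewrite [in LHS]mulr_suml coefficient_sum mulrA [RHS]mulr_sumr; apply: eq_bigr => j _.
rewrite [in LHS]mulr_sumr coefficient_sum [RHS]mulr_sumr; apply: eq_bigr => j' _.
rewrite -scalerAl -scalerAr scalerA coefficient_scale coefficient_generators.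
by ring.
Qed.

(** The scalar matrices [H H^T] and [K K^T] cancel, and [x] is unitary. *)
Lemma transported_unitary :
  transported_mx *m adjointmx transported_mx = 1%:M /\
  adjointmx transported_mx *m transported_mx = 1%:M.
Proof.
have [g1 g2] := generic_unitary.
have aH : adjointmx (map_mx (in_alg A) H) = map_mx (in_alg A) H^T.
  by apply/matrixP=> i j; rewrite !mxE star_alg (hadamard_conj hH).
have aK : adjointmx (map_mx (in_alg A) (N%:R^-1 *: K^T)) = map_mx (in_alg A) (N%:R^-1 *: K).
  by apply/matrixP=> i j; rewrite !mxE star_alg rmorphM fmorphV rmorph_nat /= (hadamard_conj hK).
have [_ HH1 HH2] := hH; have [_ KK1 KK2] := hK.
rewrite /transported_mx !adjointmx_mul aH aK.
set P := N%:R^-1 *: K^T; set Q := N%:R^-1 *: K.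
have QP : Q *m P = (N%:R^-1)%:M.
  by rewrite -scalemxAl -scalemxAr KK1 !scale_scalar_mx mulVf ?mulr1.
have PQ : P *m Q = (N%:R^-1)%:M.
  by rewrite -scalemxAl -scalemxAr KK2 !scale_scalar_mx mulVf ?mulr1.
split.
  transitivity (map_mx (in_alg A) P *m (generic_mx *m (map_mx (in_alg A) (H *m H^T) *m
      (adjointmx generic_mx *m map_mx (in_alg A) Q)))).
    by rewrite map_mxM !mulmxA.
  rewrite HH1 map_scalar_mxC -!mulmxA [generic_mx *m _]mulmxA g1 mul1mx -!map_mxM.
  by rewrite mulmxA PQ -scalar_mxM mulVf // map_mx1.
transitivity (map_mx (in_alg A) H^T *m (adjointmx generic_mx *m (map_mx (in_alg A) (Q *m P) *m
    (generic_mx *m map_mx (in_alg A) H)))).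
  by rewrite map_mxM !mulmxA.
rewrite QP map_scalar_mxC -!mulmxA [adjointmx generic_mx *m _]mulmxA g2 mul1mx -!map_mxM.
by rewrite mulmxA HH2 -scalar_mxM mulfV // map_mx1.
Qed.

Lemma signed_magic_transported : signed_magic transported_mx.
Proof.
have [u1 u2] := transported_unitary.
split=> [i j|i j j' jj|i i' j ii|i|j].
- exact: star_transported.
- apply: coefficient_inj => u v; rewrite coefficient_transported coefficient_zero.
  by rewrite black ?mulr0 // eqxx (negPf jj).
- apply: coefficient_inj => u v; rewrite coefficient_transported coefficient_zero.
  by rewrite black ?mulr0 // eqxx (negPf ii).
- transitivity ((1%:M : 'M[A]_N) i i); last by rewrite mxE eqxx.
  rewrite -u1 [RHS]mxE.
  by apply: eq_bigr => j _; rewrite [X in _ = _ * X]mxE star_transported.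
transitivity ((1%:M : 'M[A]_N) j j); last by rewrite mxE eqxx.
rewrite -u2 [RHS]mxE.
by apply: eq_bigr => i _; rewrite [X in _ = X * _]mxE star_transported.
Qed.

End Quotient.

(** Any hermitian functional with value [1] at the empty word provides a nonzero
algebra, which is all that the graphs without vertices require. *)
Definition trivial_state : word_state C nat.
Proof.
exists (fun w => (w == [::])%:R) => // w.
by rewrite rmorph_nat -!size_eq0 size_rev.
Defined.

End Graphs.

Section Existence.
Variable R : realType.
Local Notation C := (R[i]).

Definition sign_part n (H : 'M[C]_n) (i j : 'I_n) : R := complex.Re (H i j).

Lemma sign_partE n (H : 'M[C]_n) : hadamard H -> forall i j, H i j = (sign_part H i j)%:C%C.
Proof.
by case=> e _ _ i j; rewrite /sign_part; case: (e i j) => ->; rewrite ?raddfN /= ?rmorphN rmorph1.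
Qed.

Lemma sign_hadamard_part n (H : 'M[C]_n) : hadamard H -> sign_hadamard (sign_part H).
Proof.
move=> hH; have E := sign_partE hH; case: (hH) => e r c; split.
- by move=> i j; apply: complexI; rewrite rmorphM rmorph1 /= -E; case: (e i j) => ->; rewrite ?mulrNN mulr1.
- move=> j l; have /matrixP/(_ j l) := c; rewrite !mxE => cc; apply: complexI.
  rewrite rmorph_sum rmorphM /= !rmorph_nat mulr_natr -cc.
  by apply: eq_bigr => i _; rewrite mxE rmorphM /= !E.
move=> i k; have /matrixP/(_ i k) := r; rewrite !mxE => cc; apply: complexI.
rewrite rmorph_sum rmorphM /= !rmorph_nat mulr_natr -cc.
by apply: eq_bigr => j _; rewrite mxE rmorphM /= !E.
Qed.

Lemma quantum_isomorphic_hadamard (n : nat) (H K : 'M[C]_n) (c : C) :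
  hadamard H -> hadamard K ->
  quantum_isomorphic (block_mx c%:M (double H) (double H)^T 0)
                     (block_mx c%:M (double K) (double K)^T 0).
Proof.
move=> hH hK; case: (posnP n) => [n0 | n_gt0].
  subst n; pose z : 'M[word_algebra (trivial_state C)]_0 := 0.
  have mz : signed_magic z by split=> [[]|[]|[]|[]|[]].
  by apply: (quantum_isomorphic_block c mz mz); rewrite [LHS]flatmx0 [RHS]flatmx0.
have [phi [phi1 phirev rphi]] :=
  exists_functional n_gt0 (sign_hadamard_part hH) (sign_hadamard_part hK).
have state_conj w : (phi (rev w))%:C%C = ((phi w)%:C%C : C)^*.
  by rewrite phirev; apply/esym/conjc_real.
have state1 : (phi [::])%:C%C = 1 :> C by rewrite phi1.
pose psi := WordState state_conj state1.
have real_sum (I : finType) (f : I -> R) : \sum_i (f i)%:C%C = (\sum_i f i)%:C%C :> C.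
  by rewrite rmorph_sum.
have rows u v i i' : \sum_j psi (u ++ [:: (i, j); (i', j)] ++ v) = (i == i')%:R * psi (u ++ v).
  have [r _ _] := rphi u v.
  by rewrite /= real_sum r rmorphM /= rmorph_nat.
have cols u v j j' : \sum_i psi (u ++ [:: (i, j); (i, j')] ++ v) = (j == j')%:R * psi (u ++ v).
  have [_ r _] := rphi u v.
  by rewrite /= real_sum r rmorphM /= rmorph_nat.
have white u v i j i' j' : (j == j') != (i == i') ->
    psi (u ++ [:: (i, j); (i', j')] ++ v) = 0.
  move=> ne; have [_ _ /(_ false j j' i i' ne)] := rphi u v.
  rewrite /contracted /base.
  under eq_bigr do under eq_bigr do rewrite -mulrA.
  under eq_bigr do rewrite -mulr_sumr.
  rewrite sum_deltar sum_deltar.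
  under eq_bigr do under eq_bigr do rewrite -mulrA.
  under eq_bigr do rewrite -mulr_sumr.
  by rewrite sum_deltar sum_deltar /= => ->.
have black u v l l' m m' : (l == l') != (m == m') ->
    \sum_i \sum_i' K i m * K i' m' * \sum_j \sum_j' H j l * H j' l' *
    psi (u ++ [:: (i, j); (i', j')] ++ v) = 0.
  move=> ne; have [_ _ /(_ true l l' m m' ne) r] := rphi u v.
  transitivity ((contracted (sign_part H) (sign_part K) true l l' m m'
    (fun i j i' j' => phi (u ++ [:: (i, j); (i', j')] ++ v)))%:C%C : C); last by rewrite r.
  rewrite /contracted -real_sum; apply: eq_bigr => i _.
  rewrite -real_sum; apply: eq_bigr => i' _.
  rewrite rmorphM /=; congr (_ * _); first by rewrite rmorphM !(sign_partE hK).
  rewrite -real_sum; apply: eq_bigr => j _.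
  rewrite -real_sum; apply: eq_bigr => j' _.
  by rewrite !rmorphM !(sign_partE hH).
apply: (quantum_isomorphic_block c (signed_magic_generic rows cols white)
   (signed_magic_transported hH hK n_gt0 rows cols black)).
  exact: generic_mulmx.
exact: transported_mulmx.
Qed.

Lemma quantum_isomorphic_size m n (G : 'M[C]_m) (G' : 'M[C]_n) :
  quantum_isomorphic G G' -> n = m.
Proof. by case=> A [u [mu _]]; apply: magic_unitary_size mu. Qed.

End Existence.

Theorem theorem6p8 (R : realType) (N M : nat)
    (H : 'M[R[i]]_N) (K : 'M[R[i]]_M) :
  hadamard H -> hadamard K ->
  (quantum_isomorphic (hadamard_graph H) (hadamard_graph K) <->
     (4 * N = 4 * M)%N) /\
  (quantum_isomorphic (looped_hadamard_graph H) (looped_hadamard_graph K) <->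
     (4 * N = 4 * M)%N).
Proof.
move=> hH hK; split; split.
- by move/quantum_isomorphic_size; lia.
- move=> e; have eNM : N = M by lia.
  subst M; rewrite !hadamard_graphE; exact: quantum_isomorphic_hadamard.
- by move/quantum_isomorphic_size; lia.
move=> e; have eNM : N = M by lia.
subst M; rewrite !looped_hadamard_graphE; exact: quantum_isomorphic_hadamard.
Qed.
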